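(* Let $t$ be a prime number and $\zeta$ a primitive $t$-th root of unity, let $q\in\mathbb{C}$ with $|q|>1$, and let $\Sigma=\mathbb{Z}\oplus\mathbb{Z}/t\mathbb{Z}$ act on the ring $\mathcal M$ of meromorphic functions on $\mathbb{C}^*$, the first summand generated by $\sigma_q(f)(z)=f(qz)$ and the second by $\sigma_\zeta(f)(z)=f(\zeta z)$. Let $k$ be the field of $\sigma_q$-invariant meromorphic functions on $\mathbb{C}^*$, let $C$ be the $\Sigma_1$-closure of $k$ (where $\Sigma_1=\mathbb{Z}/t\mathbb{Z}$), and let $K$ be the total ring of fractions of the polynomial ring $C[z]$ with $\sigma_q(z)=qz$ and $\sigma_\zeta(z)=\zeta z$ (so $K$ is a Noetherian $\Sigma$-pseudofield whose $\sigma_q$-constants form the $\Sigma_1$-closed pseudofield $C$, and $k(z)$ embeds naturally in $K$). Let $R$ be a Picard-Vessiot ring over $K$ for the equation $\sigma_q(y)=-qz\cdot y$, and let $\theta_q(z)=-\sum_{n\in\mathbb{Z}}(-1)^nq^{-n(n-1)/2}z^n$ be Jacobi's theta-function (a solution of $\theta_q(qz)=-qz\cdot\theta_q(z)$). Then every relation of the form $$ \lambda_0 + \sum_{d=1}^{t-1}\lambda_{0d}\cdot\theta_q(z)^d+\lambda_{1d}\cdot\theta_q(\zeta z)^d+\ldots+\lambda_{t-1\, d}\cdot\theta_q(\zeta^{t-1}z)^d=0, $$ with $\lambda_0,\lambda_{ij}\in k(z)$, implies that $\lambda_0=\lambda_{ij}=0$.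
   Context: A $\Sigma_1$-closed (difference closed) pseudofield is an absolutely flat $\Sigma_1$-simple ring $A$ such that for every $\Sigma_1$-ideal $I$ of the difference polynomial ring $A\{y_1,\ldots,y_n\}_{\Sigma_1}$ one has $\sqrt{I}=\mathbb{I}(\mathbb{V}(I))$. A Picard-Vessiot ring for $\sigma Y=AY$ over $K$ is a $\Sigma$-simple $\Sigma$-ring containing $K$ that contains a fundamental matrix $F$ and is $\Sigma$-generated over $K$ by the entries of $F$ and $1/\det F$. *)

(* Defs.v *)
From Stdlib Require Import Reals Znumtheory List.
From Coquelicot Require Export Coquelicot.
Open Scope C_scope.

Definition Cpw (z : C) (n : nat) : C := @pow_n C_Ring z n.

Definition discrete_in_Cstar (S : C -> Prop) : Prop :=
  (forall z, S z -> z <> 0) /\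
  forall z : C, z <> 0 -> exists r : R, (0 < r)%R /\
    forall w : C, (0 < Cmod (w - z))%R -> (Cmod (w - z) < r)%R -> ~ S w.

(* f : C -> C represents a meromorphic function on C^* (values at poles and
   at 0 are irrelevant junk): there is a closed discrete set P of poles in C^*
   such that f is complex-differentiable at every point of C^* \ P, and at
   each p in P, (w - p)^m f(w) has a finite limit as w -> p (w <> p) for some m. *)
Definition meromorphic_Cstar (f : C -> C) : Prop :=
  exists P : C -> Prop, discrete_in_Cstar P /\
    (forall z : C, z <> 0 -> ~ P z -> @ex_derive C_AbsRing C_NormedModule f z) /\
    (forall p : C, P p -> exists (m : nat) (L : C),
        filterlim (fun w => Cpw (w - p) m * f w) (@locally' C_UniformSpace p)
                  (@locally C_UniformSpace L)).

Definition mer_eq (f g : C -> C) : Prop :=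
  exists S : C -> Prop, discrete_in_Cstar S /\
    forall z : C, z <> 0 -> ~ S z -> f z = g z.

Definition in_k (q : C) (f : C -> C) : Prop :=
  meromorphic_Cstar f /\ mer_eq (fun z => f (q * z)) f.

(* A polynomial in k[z] is given by its list of coefficients a_0, a_1, ...;
   it is viewed as the meromorphic function z |-> sum_i a_i(z) z^i. *)
Fixpoint poly_eval_aux (l : list (C -> C)) (i : nat) (z : C) : C :=
  match l with
  | nil => 0
  | a :: l' => a z * Cpw z i + poly_eval_aux l' (S i) z
  end.
Definition poly_eval (l : list (C -> C)) (z : C) : C := poly_eval_aux l 0 z.

Definition poly_over_k (q : C) (l : list (C -> C)) : Prop :=
  forall a, In a l -> in_k q a.

Definition poly_zero (l : list (C -> C)) : Prop :=
  forall a, In a l -> mer_eq a (fun _ => 0).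

(* An element of k(z) = Frac(k[z]) is a pair (P, Q) with P, Q in k[z], Q <> 0;
   it is viewed as the meromorphic function z |-> P(z)/Q(z); it is 0 iff P = 0. *)
Definition rat_over_k (q : C) (PQ : list (C -> C) * list (C -> C)) : Prop :=
  poly_over_k q (fst PQ) /\ poly_over_k q (snd PQ) /\ ~ poly_zero (snd PQ).

Definition rat_eval (PQ : list (C -> C) * list (C -> C)) (z : C) : C :=
  poly_eval (fst PQ) z / poly_eval (snd PQ) z.

Definition rat_zero (PQ : list (C -> C) * list (C -> C)) : Prop :=
  poly_zero (fst PQ).

Definition CSeries (a : nat -> C) : C :=
  (RtoC (Series (fun n => Re (a n))) + Ci * RtoC (Series (fun n => Im (a n))))%C.

(* Jacobi theta: theta_q(z) = - sum_{n in Z} (-1)^n q^{-n(n-1)/2} z^n,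
   split into n = m >= 0 and n = -(m+1) < 0 (for which -n(n-1)/2 = -(m+1)(m+2)/2). *)
Definition theta (q z : C) : C :=
  - (CSeries (fun m => Cpw (-1) m * Cinv (Cpw q (m * (m - 1) / 2)) * Cpw z m)
     + CSeries (fun m => Cpw (-1) (S m) *
                 Cinv (Cpw q ((S m) * (S (S m)) / 2) * Cpw z (S m)))).

Definition primitive_root (t : nat) (zeta : C) : Prop :=
  Cpw zeta t = 1 /\ forall j : nat, (0 < j < t)%nat -> Cpw zeta j <> 1.

(* Main.v *)
(** Fix a generic point z and evaluate the relation along the orbit q^N z. The
    coefficients of the lambda_i are q-invariant, so each lambda_i (q^N z) is a
    rational function of q^N z with coefficients independent of N, while
    theta (zeta^i q^N z) = zeta^(i N) w_N theta (zeta^i z) with w_N growing faster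
    than any exponential. Comparing growth separates the powers of w_N; in a fixed
    degree d what remains is, after clearing denominators, an exponential sum in N
    with bases zeta^(i d) q^m. These are pairwise distinct since t is prime, so
    all coefficients vanish at z wherever theta (zeta^i z) <> 0. The identity theorem
    for meromorphic functions on C^* then turns vanishing on a dense subset of a
    ball into vanishing everywhere. *)


Require Import Defs.
From Stdlib Require Import Reals Znumtheory List Lra Lia Classical ClassicalEpsilon.
From Coquelicot Require Import Coquelicot.

Open Scope R_scope.

(** The identity theorem is built on one consequence of Goursat's theorem: for a holomorphic
    function of period 2 pi i, the integral of its real part over a vertical period does not depend
    on the abscissa. In the coordinate [z0 + u e^w] vertical periods are circles around [z0], and a
    reflection in one of them turns |f|^2 on that circle into boundary values of such a function.
    This carries zeros from radius r out to radius sqrt (r R0). The second obstacle is that every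
    identity between meromorphic functions holds only off a discrete set, while the growth argument
    uses all points q^N z at once. The bad base points then form a countable union of dilated
    discrete sets, which need not be discrete, so a generic base point comes from a Baire argument.
    The conditions that are open in z (theta factor, denominators and one coefficient nonzero) are
    secured beforehand on a ball, and the generic point is chosen inside it. The relation has a
    single term of degree 0 because there all the bases zeta^(i * 0) coincide. *)

(** * Goursat's theorem for closed real 1-forms on rectangles *)

Lemma nested_intervals (a b : nat -> R) :
  (forall n, a n <= a (S n)) -> (forall n, b (S n) <= b n) ->
  (forall n, a n <= b n) -> exists x, forall n, a n <= x <= b n.
Proof.
  intros Ha Hb Hab.
  assert (Ha' : forall n m, (n <= m)%nat -> a n <= a m).
  { intros n m H. induction H; [lra|]. specialize (Ha m); lra. }
  assert (Hb' : forall n m, (n <= m)%nat -> b m <= b n).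
  { intros n m H. induction H; [lra|]. specialize (Hb m); lra. }
  destruct (completeness (fun x => exists n, x = a n)) as [x [Hx1 Hx2]].
  - exists (b 0%nat). intros x [n ->]. specialize (Hab n).
    specialize (Hb' 0%nat n ltac:(lia)). lra.
  - now exists (a 0%nat), 0%nat.
  - exists x; intros n; split.
    + apply Hx1. now exists n.
    + apply Hx2. intros y [m ->].
      destruct (Nat.le_ge_cases n m).
      * specialize (Hab m); specialize (Hb' n m H); lra.
      * specialize (Hab n); specialize (Ha' m n H); lra.
Qed.

(** Differentiability in both variables jointly: Goursat's estimate needs the linear approximation
    on a whole small rectangle, while continuity of the derivative is never assumed. *)
Definition frechet2 (P : R -> R -> R) (x0 y0 p1 p2 : R) : Prop :=
  forall eps, 0 < eps -> exists del, 0 < del /\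
    forall x y, Rabs (x - x0) < del -> Rabs (y - y0) < del ->
      Rabs (P x y - P x0 y0 - p1 * (x - x0) - p2 * (y - y0))
        <= eps * (Rabs (x - x0) + Rabs (y - y0)).

Lemma continuous_eps (f : R -> R) (x : R) :
  (forall eps, 0 < eps -> exists del, 0 < del /\
     forall y, Rabs (y - x) < del -> Rabs (f y - f x) < eps) ->
  continuous f x.
Proof.
  intros H. apply filterlim_locally. intros eps.
  destruct (H eps (cond_pos eps)) as [del [Hd Hy]].
  exists (mkposreal del Hd). intros y Hb. apply Hy. exact Hb.
Qed.

Lemma frechet2_continuous_l P x0 y0 p1 p2 :
  frechet2 P x0 y0 p1 p2 -> continuous (fun x => P x y0) x0.
Proof.
  intros H. apply continuous_eps. intros eps He.
  destruct (H 1 ltac:(lra)) as [del [Hd Hxy]].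
  pose proof (Rabs_pos p1) as Hp.
  assert (Hq : 0 < eps / (Rabs p1 + 2)) by (apply Rdiv_lt_0_compat; lra).
  exists (Rmin del (eps / (Rabs p1 + 2))). split; [now apply Rmin_pos|].
  intros y Hy.
  pose proof (Rmin_l del (eps / (Rabs p1 + 2))).
  pose proof (Rmin_r del (eps / (Rabs p1 + 2))).
  specialize (Hxy y y0). replace (y0 - y0) with 0 in Hxy by ring.
  rewrite Rabs_R0 in Hxy. specialize (Hxy ltac:(lra) Hd).
  replace (P y y0 - P x0 y0) with
    ((P y y0 - P x0 y0 - p1 * (y - x0) - p2 * 0) + p1 * (y - x0)) by ring.
  eapply Rle_lt_trans; [apply Rabs_triang|]. rewrite (Rabs_mult p1).
  assert (Hz : Rabs (y - x0) < eps / (Rabs p1 + 2)) by lra.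
  apply Rmult_lt_compat_l with (r := Rabs p1 + 2) in Hz; [|lra].
  replace ((Rabs p1 + 2) * (eps / (Rabs p1 + 2))) with eps in Hz by (field; lra).
  pose proof (Rabs_pos (y - x0)). nra.
Qed.

Lemma frechet2_swap P x0 y0 p1 p2 :
  frechet2 P x0 y0 p1 p2 -> frechet2 (fun x y => P y x) y0 x0 p2 p1.
Proof.
  intros H eps He. destruct (H eps He) as [del [Hd Hx]].
  exists del; split; [assumption|]. intros x y Hx' Hy'.
  specialize (Hx y x Hy' Hx').
  replace (P y x - P x0 y0 - p2 * (x - y0) - p1 * (y - x0))
    with (P y x - P x0 y0 - p1 * (y - x0) - p2 * (x - y0)) by ring.
  now rewrite (Rplus_comm (Rabs (x - y0))).
Qed.

Lemma ex_RInt_cont_le (f : R -> R) a b :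
  a <= b -> (forall x, a <= x <= b -> continuous f x) -> ex_RInt f a b.
Proof.
  intros Hab H. apply (ex_RInt_continuous (V := R_CompleteNormedModule)).
  rewrite Rmin_left, Rmax_right by assumption. exact H.
Qed.

Lemma RInt_near_const (f : R -> R) a b c M :
  a <= b -> ex_RInt f a b ->
  (forall x, a <= x <= b -> Rabs (f x - c) <= M) ->
  Rabs (RInt f a b - c * (b - a)) <= (b - a) * M.
Proof.
  intros Hab Hf HM.
  assert (E : RInt (fun x => f x - c) a b = RInt f a b - c * (b - a)).
  { rewrite (RInt_minus (V := R_CompleteNormedModule) f (fun _ => c));
      [|assumption|apply ex_RInt_const].
    rewrite RInt_const. change (RInt f a b - (b - a) * c = RInt f a b - c * (b - a)).
    ring. }
  rewrite <- E. apply abs_RInt_le_const; [assumption| |assumption].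
  apply (ex_RInt_minus (V := R_NormedModule)); [assumption|apply ex_RInt_const].
Qed.

(* The circulation of P dx + Q dy along the boundary of [a,b] x [c,d]. *)
Definition circ (P Q : R -> R -> R) (a b c d : R) : R :=
  RInt (fun x => P x c) a b + RInt (Q b) c d
  - RInt (fun x => P x d) a b - RInt (Q a) c d.

Section Green.
Variables P Q : R -> R -> R.

(** The shared [s] is the equation dP/dy = dQ/dx. *)
Definition closed_form_at (x y : R) : Prop :=
  exists p s q, frechet2 P x y p s /\ frechet2 Q x y s q.

Definition closed_form_on (a b c d : R) : Prop :=
  forall x y, a <= x <= b -> c <= y <= d -> closed_form_at x y.

Lemma closed_form_ex_RInt_l a b c d y :
  closed_form_on a b c d -> a <= b -> c <= y <= d -> ex_RInt (fun x => P x y) a b.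
Proof.
  intros H Hab Hy. apply ex_RInt_cont_le; [assumption|]. intros x Hx.
  destruct (H x y Hx Hy) as (p & s & q & H1 & _).
  exact (frechet2_continuous_l _ _ _ _ _ H1).
Qed.

Lemma closed_form_ex_RInt_r a b c d x :
  closed_form_on a b c d -> c <= d -> a <= x <= b -> ex_RInt (Q x) c d.
Proof.
  intros H Hcd Hx. apply ex_RInt_cont_le; [assumption|]. intros y Hy.
  destruct (H x y Hx Hy) as (p & s & q & _ & H2).
  exact (frechet2_continuous_l _ _ _ _ _ (frechet2_swap _ _ _ _ _ H2)).
Qed.

Lemma closed_form_on_sub a b c d a' b' c' d' :
  closed_form_on a b c d -> a <= a' -> b' <= b -> c <= c' -> d' <= d ->
  closed_form_on a' b' c' d'.
Proof. intros H ? ? ? ? x y Hx Hy. apply H; lra. Qed.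

Lemma circ_split_l a m b c d :
  closed_form_on a b c d -> a <= m <= b -> c <= d ->
  circ P Q a b c d = circ P Q a m c d + circ P Q m b c d.
Proof.
  intros H Hm Hcd. unfold circ.
  assert (E : forall y, c <= y <= d -> RInt (fun x => P x y) a b
     = RInt (fun x => P x y) a m + RInt (fun x => P x y) m b).
  { intros y Hy. symmetry. apply (RInt_Chasles (V := R_CompleteNormedModule)).
    - apply (closed_form_ex_RInt_l a m c d); try lra.
      eapply closed_form_on_sub; [exact H|lra..].
    - apply (closed_form_ex_RInt_l m b c d); try lra.
      eapply closed_form_on_sub; [exact H|lra..]. }
  rewrite (E c), (E d) by lra. ring.
Qed.

Lemma circ_split_r a b c m d :
  closed_form_on a b c d -> a <= b -> c <= m <= d ->
  circ P Q a b c d = circ P Q a b c m + circ P Q a b m d.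
Proof.
  intros H Hab Hm. unfold circ.
  assert (E : forall x, a <= x <= b -> RInt (Q x) c d
     = RInt (Q x) c m + RInt (Q x) m d).
  { intros x Hx. symmetry. apply (RInt_Chasles (V := R_CompleteNormedModule)).
    - apply (closed_form_ex_RInt_r a b c m); try lra.
      eapply closed_form_on_sub; [exact H|lra..].
    - apply (closed_form_ex_RInt_r a b m d); try lra.
      eapply closed_form_on_sub; [exact H|lra..]. }
  rewrite (E a), (E b) by lra. ring.
Qed.

(** Circulation is additive, so of two halves one carries at least half of its absolute value; this
    is used once in each direction. *)
Lemma circ_quarter a b c d :
  closed_form_on a b c d -> a <= b -> c <= d ->
  exists a' c', (a' = a \/ a' = (a + b) / 2) /\ (c' = c \/ c' = (c + d) / 2) /\
    Rabs (circ P Q a b c d) / 4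
      <= Rabs (circ P Q a' (a' + (b - a) / 2) c' (c' + (d - c) / 2)).
Proof.
  intros H Hab Hcd.
  assert (Hx : exists a', (a' = a \/ a' = (a + b) / 2) /\
     Rabs (circ P Q a b c d) / 2 <= Rabs (circ P Q a' (a' + (b - a) / 2) c d)).
  { pose proof (circ_split_l a ((a + b) / 2) b c d H ltac:(lra) Hcd) as E.
    destruct (Rle_dec (Rabs (circ P Q a b c d) / 2)
                      (Rabs (circ P Q a ((a + b) / 2) c d))) as [L|L].
    - exists a. split; [now left|].
      now replace (a + (b - a) / 2) with ((a + b) / 2) by field.
    - exists ((a + b) / 2). split; [now right|].
      replace ((a + b) / 2 + (b - a) / 2) with b by field.
      pose proof (Rabs_triang (circ P Q a ((a + b) / 2) c d) (circ P Q ((a + b) / 2) b c d)).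
      rewrite <- E in H0. lra. }
  destruct Hx as [a' [Ha' HA]]. set (b' := a' + (b - a) / 2) in *.
  assert (H' : closed_form_on a' b' c d).
  { eapply closed_form_on_sub; [exact H|..]; unfold b'; destruct Ha'; lra. }
  pose proof (circ_split_r a' b' c ((c + d) / 2) d H'
                ltac:(unfold b'; lra) ltac:(lra)) as E.
  destruct (Rle_dec (Rabs (circ P Q a' b' c d) / 2)
                    (Rabs (circ P Q a' b' c ((c + d) / 2)))) as [L|L].
  - exists a', c. split; [assumption|]. split; [now left|].
    fold b'. replace (c + (d - c) / 2) with ((c + d) / 2) by field. lra.
  - exists a', ((c + d) / 2). split; [assumption|]. split; [now right|].
    fold b'. replace ((c + d) / 2 + (d - c) / 2) with d by field.
    pose proof (Rabs_triang (circ P Q a' b' c ((c + d) / 2)) (circ P Q a' b' ((c + d) / 2) d)).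
    rewrite <- E in H0. lra.
Qed.

(** On opposite sides the constant terms and the [p], [q] terms cancel. What is left of the linear
    parts is [s * (c - d) * (b - a)] and [s * (b - a) * (d - c)], which cancel by closedness. The
    factor 2 counts the two error terms, one for each of the opposite sides. *)
Lemma circ_small a b c d x0 y0 p s q eps del :
  closed_form_on a b c d -> a <= x0 <= b -> c <= y0 <= d ->
  0 < eps ->
  (forall x y, Rabs (x - x0) < del -> Rabs (y - y0) < del ->
      Rabs (P x y - P x0 y0 - p * (x - x0) - s * (y - y0))
        <= eps * (Rabs (x - x0) + Rabs (y - y0))) ->
  (forall x y, Rabs (x - x0) < del -> Rabs (y - y0) < del ->
      Rabs (Q x y - Q x0 y0 - s * (x - x0) - q * (y - y0))
        <= eps * (Rabs (x - x0) + Rabs (y - y0))) ->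
  b - a < del -> d - c < del ->
  Rabs (circ P Q a b c d) <= 2 * eps * (b - a + (d - c)) ^ 2.
Proof.
  intros H Hx0 Hy0 He HP HQ Hab Hcd.
  set (L := b - a + (d - c)).
  assert (Bd : forall x y, a <= x <= b -> c <= y <= d ->
    Rabs (x - x0) < del /\ Rabs (y - y0) < del /\
    eps * (Rabs (x - x0) + Rabs (y - y0)) <= eps * L).
  { intros x y Hx Hy.
    assert (Rabs (x - x0) <= b - a) by (apply Rabs_le; lra).
    assert (Rabs (y - y0) <= d - c) by (apply Rabs_le; lra).
    repeat split; try lra. unfold L. apply Rmult_le_compat_l; lra. }
  assert (EP : forall y, c <= y <= d -> ex_RInt (fun x => P x y) a b).
  { intros y Hy. apply (closed_form_ex_RInt_l a b c d); auto; lra. }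
  assert (EQ : forall x, a <= x <= b -> ex_RInt (Q x) c d).
  { intros y Hy. apply (closed_form_ex_RInt_r a b c d); auto; lra. }
  assert (I1 : Rabs (RInt (fun x => P x c - P x d) a b - (s * (c - d)) * (b - a))
               <= (b - a) * (2 * eps * L)).
  { apply RInt_near_const; [lra| |].
    - apply (ex_RInt_minus (V := R_NormedModule)); apply EP; lra.
    - intros x Hx.
      destruct (Bd x c Hx ltac:(lra)) as (B1 & B2 & B3).
      destruct (Bd x d Hx ltac:(lra)) as (B4 & B5 & B6).
      pose proof (HP x c B1 B2) as G1. pose proof (HP x d B4 B5) as G2.
      replace (P x c - P x d - s * (c - d)) with
       ((P x c - P x0 y0 - p * (x - x0) - s * (c - y0)) -
        (P x d - P x0 y0 - p * (x - x0) - s * (d - y0))) by ring.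
      eapply Rle_trans; [apply Rabs_triang|]. rewrite Rabs_Ropp. lra. }
  assert (I2 : Rabs (RInt (fun y => Q b y - Q a y) c d - (s * (b - a)) * (d - c))
               <= (d - c) * (2 * eps * L)).
  { apply RInt_near_const; [lra| |].
    - apply (ex_RInt_minus (V := R_NormedModule)); apply EQ; lra.
    - intros y Hy.
      destruct (Bd b y ltac:(lra) Hy) as (B1 & B2 & B3).
      destruct (Bd a y ltac:(lra) Hy) as (B4 & B5 & B6).
      pose proof (HQ b y B1 B2) as G1. pose proof (HQ a y B4 B5) as G2.
      replace (Q b y - Q a y - s * (b - a)) with
       ((Q b y - Q x0 y0 - s * (b - x0) - q * (y - y0)) -
        (Q a y - Q x0 y0 - s * (a - x0) - q * (y - y0))) by ring.
      eapply Rle_trans; [apply Rabs_triang|]. rewrite Rabs_Ropp. lra. }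
  assert (J1 : RInt (fun x => P x c - P x d) a b
     = RInt (fun x => P x c) a b - RInt (fun x => P x d) a b).
  { apply (RInt_minus (V := R_CompleteNormedModule)); apply EP; lra. }
  assert (J2 : RInt (fun y => Q b y - Q a y) c d
     = RInt (Q b) c d - RInt (Q a) c d).
  { apply (RInt_minus (V := R_CompleteNormedModule)); apply EQ; lra. }
  rewrite J1 in I1. rewrite J2 in I2. unfold circ.
  replace (RInt (fun x => P x c) a b + RInt (Q b) c d - RInt (fun x => P x d) a b - RInt (Q a) c d)
   with ((RInt (fun x => P x c) a b - RInt (fun x => P x d) a b - s * (c - d) * (b - a))
     + (RInt (Q b) c d - RInt (Q a) c d - s * (b - a) * (d - c))) by ring.
  eapply Rle_trans; [apply Rabs_triang|].
  replace (2 * eps * L ^ 2) with ((b - a) * (2 * eps * L) + (d - c) * (2 * eps * L))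
    by (unfold L; ring).
  lra.
Qed.

(* Goursat's bisection argument. *)
Lemma circ_closed_form a b c d :
  a <= b -> c <= d -> closed_form_on a b c d -> circ P Q a b c d = 0.
Proof.
  intros Hab Hcd H.
  set (W := fun n => (b - a) / 2 ^ n). set (V := fun n => (d - c) / 2 ^ n).
  assert (H2 : forall n, 0 < 2 ^ n) by (intros; apply pow_lt; lra).
  assert (WS : forall n, W (S n) = W n / 2).
  { intros n. unfold W. simpl. field. apply Rgt_not_eq, H2. }
  assert (VS : forall n, V (S n) = V n / 2).
  { intros n. unfold V. simpl. field. apply Rgt_not_eq, H2. }
  assert (W0 : forall n, 0 <= W n).
  { intros n. unfold W. apply Rmult_le_pos; [lra|]. left; apply Rinv_0_lt_compat, H2. }
  assert (V0 : forall n, 0 <= V n).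
  { intros n. unfold V. apply Rmult_le_pos; [lra|]. left; apply Rinv_0_lt_compat, H2. }
  set (good := fun (n : nat) (s : R * R) =>
     a <= fst s /\ fst s + W n <= b /\ c <= snd s /\ snd s + V n <= d /\
     Rabs (circ P Q a b c d) / 4 ^ n
       <= Rabs (circ P Q (fst s) (fst s + W n) (snd s) (snd s + V n))).
  (* The premise [good n s] stands inside the existential so that choice yields a step function
     defined on all pairs. *)
  assert (step : forall n s, exists s', good n s -> good (S n) s' /\
      fst s <= fst s' /\ fst s' + W (S n) <= fst s + W n /\
      snd s <= snd s' /\ snd s' + V (S n) <= snd s + V n).
  { intros n [x y]. destruct (classic (good n (x, y))) as [G|G]; [|now exists (x, y)].
    destruct G as (G1 & G2 & G3 & G4 & G5). simpl in *.
    destruct (circ_quarter x (x + W n) y (y + V n)) as (x' & y' & Hx' & Hy' & Hq).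
    - eapply closed_form_on_sub; [exact H|lra..].
    - specialize (W0 n); lra.
    - specialize (V0 n); lra.
    - exists (x', y'). intros _. unfold good. simpl fst. simpl snd.
      replace (x + W n - x) with (W n) in Hq by ring.
      replace (y + V n - y) with (V n) in Hq by ring.
      rewrite <- WS, <- VS in Hq. pose proof (WS n). pose proof (VS n).
      specialize (W0 n). specialize (V0 n).
      repeat split; try (destruct Hx'; lra); try (destruct Hy'; lra).
      eapply Rle_trans; [|exact Hq].
      assert (0 < 4 ^ n) by (apply pow_lt; lra).
      replace (Rabs (circ P Q a b c d) / 4 ^ S n)
        with (Rabs (circ P Q a b c d) / 4 ^ n / 4) by (simpl; field; lra).
      lra. }
  set (next := fun n s => proj1_sig (constructive_indefinite_description _ (step n s))).
  set (u := fix u n := match n with O => (a, c) | S m => next m (u m) end).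
  assert (Hu : forall n, good n (u n)).
  { induction n.
    - unfold good, W, V; simpl. repeat split; try lra.
      replace (a + (b - a) / 1) with b by field.
      replace (c + (d - c) / 1) with d by field. lra.
    - simpl. unfold next. destruct (constructive_indefinite_description _ (step n (u n))) as [s' Hs].
      simpl. apply Hs, IHn. }
  assert (Hn : forall n, fst (u n) <= fst (u (S n)) /\
      fst (u (S n)) + W (S n) <= fst (u n) + W n /\
      snd (u n) <= snd (u (S n)) /\ snd (u (S n)) + V (S n) <= snd (u n) + V n).
  { intros n. simpl. unfold next.
    destruct (constructive_indefinite_description _ (step n (u n))) as [s' Hs].
    simpl. apply Hs, Hu. }
  destruct (nested_intervals (fun n => fst (u n)) (fun n => fst (u n) + W n)) as [x0 Hx0].
  { apply Hn. } { apply Hn. } { intros n; specialize (W0 n); lra. }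
  destruct (nested_intervals (fun n => snd (u n)) (fun n => snd (u n) + V n)) as [y0 Hy0].
  { intros; apply Hn. } { intros; apply Hn. } { intros n; specialize (V0 n); lra. }
  destruct (H x0 y0) as (p & s & q & FP & FQ).
  { specialize (Hx0 0%nat). unfold W in Hx0; simpl in Hx0. lra. }
  { specialize (Hy0 0%nat). unfold V in Hy0; simpl in Hy0. lra. }
  set (L := b - a + (d - c)).
  (* After n quarterings the lower bound on the circulation and the upper bound from [circ_small]
     both carry the factor 4^(-n), which drops out. *)
  assert (Small : forall eps, 0 < eps -> Rabs (circ P Q a b c d) <= 2 * eps * L ^ 2).
  { intros eps He.
    destruct (FP eps He) as [d1 [Hd1 G1]]. destruct (FQ eps He) as [d2 [Hd2 G2]].
    pose proof (Rmin_l d1 d2) as M1. pose proof (Rmin_r d1 d2) as M2.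
    assert (M : 0 < Rmin d1 d2) by now apply Rmin_pos.
    (* [L + 1] instead of [L] keeps the quotient meaningful for a rectangle reduced to a point. *)
    destruct (pow_lt_1_zero (/ 2) ltac:(rewrite Rabs_right; lra)
                (Rmin d1 d2 / (L + 1))) as [n Hnn].
    { apply Rdiv_lt_0_compat; unfold L; lra. }
    specialize (Hnn n (le_n n)). rewrite Rabs_right in Hnn.
    2:{ apply Rle_ge, pow_le. lra. }
    rewrite pow_inv in Hnn.
    assert (HL : L / 2 ^ n < Rmin d1 d2).
    { apply Rmult_lt_compat_l with (r := L + 1) in Hnn; [|unfold L; lra].
      replace ((L + 1) * (Rmin d1 d2 / (L + 1))) with (Rmin d1 d2) in Hnn
        by (field; unfold L; lra).
      assert (0 < / 2 ^ n) by apply Rinv_0_lt_compat, H2. unfold Rdiv. lra. }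
    assert (HWV : W n + V n = L / 2 ^ n).
    { unfold W, V, L. field. apply Rgt_not_eq, H2. }
    destruct (Hu n) as (U1 & U2 & U3 & U4 & U5).
    assert (C1 : Rabs (circ P Q (fst (u n)) (fst (u n) + W n) (snd (u n)) (snd (u n) + V n))
       <= 2 * eps * (fst (u n) + W n - fst (u n) + (snd (u n) + V n - snd (u n))) ^ 2).
    { specialize (W0 n). specialize (V0 n).
      apply circ_small with (x0 := x0) (y0 := y0) (p := p) (s := s) (q := q)
         (del := Rmin d1 d2); auto; try lra.
      - eapply closed_form_on_sub; [exact H|lra..].
      - intros; apply G1; lra.
      - intros; apply G2; lra. }
    replace (fst (u n) + W n - fst (u n) + (snd (u n) + V n - snd (u n))) with (L / 2 ^ n) in C1
      by (rewrite <- HWV; ring).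
    assert (H4 : 4 ^ n = 2 ^ n * 2 ^ n).
    { rewrite <- Rpow_mult_distr. f_equal; lra. }
    assert (0 < 4 ^ n) by (apply pow_lt; lra).
    pose proof (Rle_trans _ _ _ U5 C1) as T.
    replace (2 * eps * (L / 2 ^ n) ^ 2) with (2 * eps * L ^ 2 / 4 ^ n) in T
      by (rewrite H4; field; apply Rgt_not_eq, H2).
    unfold Rdiv in T. apply Rmult_le_reg_r in T; [exact T|now apply Rinv_0_lt_compat]. }
  destruct (Req_dec (circ P Q a b c d) 0) as [E|E]; [exact E|exfalso].
  pose proof (Rabs_pos_lt _ E) as E'.
  assert (HL2 : 0 <= L ^ 2) by apply pow2_ge_0.
  (* This [eps] makes the upper bound at most half of the circulation it bounds. *)
  specialize (Small (Rabs (circ P Q a b c d) / (4 * (L ^ 2 + 1)))).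
  assert (Q0 : 0 < Rabs (circ P Q a b c d) / (4 * (L ^ 2 + 1))).
  { apply Rdiv_lt_0_compat; lra. }
  specialize (Small Q0).
  assert (2 * (Rabs (circ P Q a b c d) / (4 * (L ^ 2 + 1))) * L ^ 2
     <= Rabs (circ P Q a b c d) / 2); [|lra].
  replace (Rabs (circ P Q a b c d) / 2) with
    (2 * (Rabs (circ P Q a b c d) / (4 * (L ^ 2 + 1))) * (L ^ 2 + 1)) by (field; lra).
  apply Rmult_le_compat_l; lra.
Qed.

End Green.

Open Scope C_scope.

(** * Complex continuity and differentiability *)

Definition Ccont (f : C -> C) (z : C) : Prop :=
  forall eps : R, (0 < eps)%R -> exists del : R, (0 < del)%R /\
    forall w, (Cmod (w - z) < del)%R -> (Cmod (f w - f z) < eps)%R.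

Lemma Ccont_const c z : Ccont (fun _ => c) z.
Proof.
  intros eps He. exists 1%R. split; [lra|]. intros w _.
  replace (c - c) with (RtoC 0) by ring. now rewrite Cmod_0.
Qed.

Lemma Ccont_id z : Ccont (fun w => w) z.
Proof. intros eps He. now exists eps. Qed.

Lemma Ccont_plus f g z : Ccont f z -> Ccont g z -> Ccont (fun w => f w + g w) z.
Proof.
  intros Hf Hg eps He.
  destruct (Hf (eps / 2)%R ltac:(lra)) as [d1 [D1 H1]].
  destruct (Hg (eps / 2)%R ltac:(lra)) as [d2 [D2 H2]].
  exists (Rmin d1 d2). split; [now apply Rmin_pos|]. intros w Hw.
  pose proof (Rmin_l d1 d2). pose proof (Rmin_r d1 d2).
  replace (f w + g w - (f z + g z)) with ((f w - f z) + (g w - g z)) by ring.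
  eapply Rle_lt_trans; [apply Cmod_triangle|].
  specialize (H1 w ltac:(lra)). specialize (H2 w ltac:(lra)). lra.
Qed.

Lemma Ccont_mult f g z : Ccont f z -> Ccont g z -> Ccont (fun w => f w * g w) z.
Proof.
  intros Hf Hg eps He.
  set (A := Cmod (f z)). set (B := Cmod (g z)).
  assert (HA : (0 <= A)%R) by apply Cmod_ge_0.
  assert (HB : (0 <= B)%R) by apply Cmod_ge_0.
  set (e := Rmin 1 (eps / (A + B + 2))%R).
  assert (E0 : (0 < eps / (A + B + 2))%R) by (apply Rdiv_lt_0_compat; lra).
  assert (He0 : (0 < e)%R) by (apply Rmin_pos; lra).
  assert (E1 : (e <= 1)%R) by apply Rmin_l.
  assert (E2 : (e * (A + B + 2) <= eps)%R).
  { replace eps with (eps / (A + B + 2) * (A + B + 2))%R by (field; lra).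
    apply Rmult_le_compat_r; [lra|apply Rmin_r]. }
  destruct (Hf e He0) as [d1 [D1 H1]]. destruct (Hg e He0) as [d2 [D2 H2]].
  exists (Rmin d1 d2). split; [now apply Rmin_pos|]. intros w Hw.
  pose proof (Rmin_l d1 d2). pose proof (Rmin_r d1 d2).
  specialize (H1 w ltac:(lra)). specialize (H2 w ltac:(lra)).
  replace (f w * g w - f z * g z) with
    ((f w - f z) * (g w - g z) + (f z * (g w - g z) + (f w - f z) * g z)) by ring.
  eapply Rle_lt_trans; [apply Cmod_triangle|].
  eapply Rle_lt_trans; [apply Rplus_le_compat_l, Cmod_triangle|].
  rewrite !Cmod_mult. fold A B.
  pose proof (Cmod_ge_0 (f w - f z)). pose proof (Cmod_ge_0 (g w - g z)). nra.
Qed.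

Lemma Ccont_comp f g z : Ccont g z -> Ccont f (g z) -> Ccont (fun w => f (g w)) z.
Proof.
  intros Hg Hf eps He. destruct (Hf eps He) as [d [D H]].
  destruct (Hg d D) as [d' [D' H']]. exists d'. split; auto.
Qed.

Lemma Ccont_conj f z : Ccont f (Cconj z) -> Ccont (fun w => Cconj (f (Cconj w))) z.
Proof.
  intros Hf eps He. destruct (Hf eps He) as [d [D H]].
  exists d. split; [assumption|]. intros w Hw.
  rewrite <- Cminus_conj, Cmod_conj. apply H.
  now rewrite <- Cminus_conj, Cmod_conj.
Qed.

Lemma Ccont_neq0 f z : Ccont f z -> f z <> 0 ->
  exists r : R, (0 < r)%R /\ forall w, (Cmod (w - z) < r)%R -> f w <> 0.
Proof.
  intros Hf Hz. apply Cmod_gt_0 in Hz. destruct (Hf _ Hz) as [d [D H]].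
  exists d. split; [assumption|]. intros w Hw E. specialize (H w Hw).
  rewrite E in H. replace (0 - f z) with (- f z) in H by ring.
  rewrite Cmod_opp in H. lra.
Qed.

(* Caratheodory's form of complex differentiability. *)
Definition Cdiff (f : C -> C) (z : C) : Prop :=
  exists phi, Ccont phi z /\ forall w, f w = f z + phi w * (w - z).

Lemma Cdiff_cont f z : Cdiff f z -> Ccont f z.
Proof.
  intros [phi [Hp H]].
  assert (G : Ccont (fun w => f z + phi w * (w + - z)) z).
  { apply Ccont_plus; [apply Ccont_const|]. apply Ccont_mult; [assumption|].
    apply Ccont_plus; [apply Ccont_id|apply Ccont_const]. }
  intros eps He. destruct (G eps He) as [d [D K]]. exists d; split; [assumption|].
  intros w Hw. specialize (K w Hw).
  replace (f z + phi z * (z + - z)) with (f z) in K by ring.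
  now rewrite (H w).
Qed.

Lemma Cdiff_const c z : Cdiff (fun _ => c) z.
Proof. exists (fun _ => 0). split; [apply Ccont_const|]. intros; ring. Qed.

Lemma Cdiff_id z : Cdiff (fun w => w) z.
Proof. exists (fun _ => 1). split; [apply Ccont_const|]. intros; ring. Qed.

Lemma Cdiff_plus f g z : Cdiff f z -> Cdiff g z -> Cdiff (fun w => f w + g w) z.
Proof.
  intros [p [Hp H]] [s [Hs G]]. exists (fun w => p w + s w).
  split; [now apply Ccont_plus|]. intros w. rewrite (H w), (G w). ring.
Qed.

Lemma Cdiff_mult f g z : Cdiff f z -> Cdiff g z -> Cdiff (fun w => f w * g w) z.
Proof.
  intros Hf Hg. pose proof (Cdiff_cont _ _ Hg) as Gc.
  destruct Hf as [p [Hp H]]. destruct Hg as [s [Hs G]].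
  exists (fun w => p w * g w + f z * s w). split.
  - apply Ccont_plus; apply Ccont_mult; auto. apply Ccont_const.
  - intros w. rewrite (H w), (G w). ring.
Qed.

Lemma Cdiff_comp f g z : Cdiff g z -> Cdiff f (g z) -> Cdiff (fun w => f (g w)) z.
Proof.
  intros Hg Hf. pose proof (Cdiff_cont _ _ Hg) as Gc.
  destruct Hg as [s [Hs G]]. destruct Hf as [p [Hp H]].
  exists (fun w => p (g w) * s w). split.
  - apply Ccont_mult; [|assumption]. now apply Ccont_comp.
  - intros w. rewrite (H (g w)). rewrite (G w) at 2. ring.
Qed.

(** Conjugating both argument and value preserves holomorphy; the reflection in
    [zero_propagates_circle] relies on it. *)
Lemma Cdiff_conj f z : Cdiff f (Cconj z) -> Cdiff (fun w => Cconj (f (Cconj w))) z.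
Proof.
  intros [p [Hp H]]. exists (fun w => Cconj (p (Cconj w))). split.
  - now apply Ccont_conj.
  - intros w. rewrite (H (Cconj w)), Cplus_conj, Cmult_conj, Cminus_conj, !Cconj_conj.
    reflexivity.
Qed.

Lemma Cdiff_ext_loc f g z (r : R) : (0 < r)%R ->
  (forall w, (Cmod (w - z) < r)%R -> f w = g w) -> Cdiff f z -> Cdiff g z.
Proof.
  intros Hr E [p [Hp H]].
  (* The slope identity must hold for every [w], so outside the ball, where [w <> z], the slope is
     the difference quotient of [g] itself. *)
  exists (fun w => if Rlt_dec (Cmod (w - z)) r then p w else (g w - g z) / (w - z)).
  assert (Ez : f z = g z).
  { apply E. replace (z - z) with (RtoC 0) by ring. now rewrite Cmod_0. }
  split.
  - intros eps He. destruct (Hp eps He) as [d [D K]].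
    exists (Rmin d r). split; [now apply Rmin_pos|]. intros w Hw.
    pose proof (Rmin_l d r). pose proof (Rmin_r d r).
    destruct (Rlt_dec (Cmod (w - z)) r); [|lra].
    destruct (Rlt_dec (Cmod (z - z)) r) as [|n].
    + apply K. lra.
    + exfalso; apply n. replace (z - z) with (RtoC 0) by ring. now rewrite Cmod_0.
  - intros w. destruct (Rlt_dec (Cmod (w - z)) r) as [L|L].
    + now rewrite <- (E w L), (H w), Ez.
    + field. intros Z. apply L. rewrite Z, Cmod_0. exact Hr.
Qed.

Lemma Cdiff_of_eps f z l :
  (forall eps : R, (0 < eps)%R -> exists del : R, (0 < del)%R /\
    forall w, (Cmod (w - z) < del)%R ->
      (Cmod (f w - f z - l * (w - z)) <= eps * Cmod (w - z))%R) ->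
  Cdiff f z.
Proof.
  intros H.
  set (phi := fun w => if excluded_middle_informative (w = z) then l
                       else (f w - f z) / (w - z)).
  exists phi. split.
  - intros eps He. destruct (H (eps / 2)%R ltac:(lra)) as [d [D K]].
    exists d. split; [assumption|]. intros w Hw. specialize (K w Hw).
    unfold phi. destruct (excluded_middle_informative (z = z)) as [_|]; [|tauto].
    destruct (excluded_middle_informative (w = z)) as [E|E].
    + replace (l - l) with (RtoC 0) by ring. now rewrite Cmod_0.
    + assert (Hz : w - z <> 0).
      { intros Z. apply E. rewrite <- (Cplus_0_l z), <- Z. ring. }
      pose proof (proj1 (Cmod_gt_0 _) Hz) as P.
      replace ((f w - f z) / (w - z) - l) with ((f w - f z - l * (w - z)) / (w - z))
        by (field; assumption).
      rewrite Cmod_div by assumption.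
      apply (Rmult_lt_reg_r (Cmod (w - z))); [assumption|].
      replace (Cmod (f w - f z - l * (w - z)) / Cmod (w - z) * Cmod (w - z))%R
        with (Cmod (f w - f z - l * (w - z))) by (field; lra).
      nra.
  - intros w. unfold phi. destruct (excluded_middle_informative (w = z)) as [->|E].
    + ring.
    + field. intros Z. apply E. rewrite <- (Cplus_0_l z), <- Z. ring.
Qed.

Lemma Cdiff_eps f z : Cdiff f z -> exists l,
  forall eps : R, (0 < eps)%R -> exists del : R, (0 < del)%R /\
    forall w, (Cmod (w - z) < del)%R ->
      (Cmod (f w - f z - l * (w - z)) <= eps * Cmod (w - z))%R.
Proof.
  intros [p [Hp H]]. exists (p z). intros eps He. destruct (Hp eps He) as [d [D K]].
  exists d. split; [assumption|]. intros w Hw.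
  replace (f w - f z - p z * (w - z)) with ((p w - p z) * (w - z))
    by (rewrite (H w); ring).
  rewrite Cmod_mult. apply Rmult_le_compat_r; [apply Cmod_ge_0|].
  left. now apply K.
Qed.

Lemma ex_derive_Cdiff f z : @ex_derive C_AbsRing C_NormedModule f z -> Cdiff f z.
Proof.
  intros [l [_ H]]. apply Cdiff_of_eps with l.
  intros eps He. specialize (H z (fun P HP => HP) (mkposreal eps He)).
  destruct H as [d Hd]. exists d. split; [apply cond_pos|]. intros w Hw.
  specialize (Hd w Hw). simpl in Hd.
  replace (f w - f z - l * (w - z)) with
    (minus (minus (f w) (f z)) (scal (minus w z) l)).
  - exact Hd.
  - change (f w - f z - (w - z) * l = f w - f z - l * (w - z)). ring.
Qed.

Lemma Cmod_le_abs z : (Cmod z <= Rabs (Re z) + Rabs (Im z))%R.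
Proof.
  replace z with (RtoC (Re z) + Ci * RtoC (Im z)) at 1.
  - eapply Rle_trans; [apply Cmod_triangle|].
    rewrite Cmod_mult, Cmod_Ci, !Cmod_R. lra.
  - destruct z as [x y]. unfold Re, Im, Ci, RtoC, Cplus, Cmult; simpl. f_equal; ring.
Qed.

Lemma im_le_Cmod z : (Rabs (Im z) <= Cmod z)%R.
Proof. eapply Rle_trans; [apply Rmax_r|apply Rmax_Cmod]. Qed.

(** The form is the imaginary part of h dz. With h' = l1 + i l2, the Cauchy-Riemann equations give
    Im h the gradient (l2, l1) and Re h the gradient (l1, -l2), so the shared coefficient is l1. *)
Lemma Cdiff_closed_form h x y : Cdiff h (x, y) ->
  closed_form_at (fun a b => Im (h (a, b))) (fun a b => Re (h (a, b))) x y.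
Proof.
  intros H. apply Cdiff_eps in H. destruct H as [[l1 l2] H].
  exists l2, l1, (- l2)%R.
  assert (G : forall eps : R, (0 < eps)%R -> exists del : R, (0 < del)%R /\
    forall a b, (Rabs (a - x) < del)%R -> (Rabs (b - y) < del)%R ->
     (Cmod (h (a, b) - h (x, y) - (l1, l2) * ((a, b) - (x, y)))
        <= eps * (Rabs (a - x) + Rabs (b - y)))%R).
  { intros eps He. destruct (H eps He) as [d [D K]].
    exists (d / 2)%R. split; [lra|]. intros a b Ha Hb.
    pose proof (Cmod_le_abs ((a, b) - (x, y))) as B.
    change (Re ((a, b) - (x, y))) with (a - x)%R in B.
    change (Im ((a, b) - (x, y))) with (b - y)%R in B.
    eapply Rle_trans; [apply K; lra|]. apply Rmult_le_compat_l; lra. }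
  split; intros eps He; destruct (G eps He) as [d [D K]]; exists d;
    (split; [assumption|]); intros a b Ha Hb;
    (eapply Rle_trans; [|apply (K a b Ha Hb)]).
  - eapply Rle_trans; [|apply im_le_Cmod]. right. f_equal.
    destruct (h (a, b)), (h (x, y)). unfold Im; simpl. ring.
  - eapply Rle_trans; [|apply re_le_Cmod]. right. f_equal.
    destruct (h (a, b)), (h (x, y)). unfold Re; simpl. ring.
Qed.

(** * The complex exponential *)

Definition Cexp (w : C) : C :=
  ((exp (fst w) * cos (snd w))%R, (exp (fst w) * sin (snd w))%R).

Lemma Cexp_plus a b : Cexp (a + b) = Cexp a * Cexp b.
Proof.
  destruct a as [a1 a2], b as [b1 b2]. unfold Cexp, Cmult; simpl.
  rewrite exp_plus, cos_plus, sin_plus. f_equal; ring.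
Qed.

Lemma Cexp_0 : Cexp 0 = 1.
Proof. unfold Cexp; simpl. rewrite exp_0, cos_0, sin_0. unfold RtoC. f_equal; ring. Qed.

Lemma Cexp_period x y : Cexp (x, (y + 2 * PI)%R) = Cexp (x, y).
Proof.
  unfold Cexp; simpl fst; simpl snd.
  rewrite cos_plus, sin_plus, cos_2PI, sin_2PI. f_equal; ring.
Qed.

Lemma Cmod_Cexp w : Cmod (Cexp w) = exp (fst w).
Proof.
  unfold Cmod, Cexp; simpl fst; simpl snd.
  replace ((exp (fst w) * cos (snd w)) ^ 2 + (exp (fst w) * sin (snd w)) ^ 2)%R
    with ((exp (fst w)) ^ 2)%R.
  - rewrite sqrt_pow2; [reflexivity|]. left; apply exp_pos.
  - pose proof (sin2_cos2 (snd w)) as E. unfold Rsqr in E.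
    replace ((exp (fst w) * cos (snd w)) ^ 2 + (exp (fst w) * sin (snd w)) ^ 2)%R
      with (exp (fst w) ^ 2 * (sin (snd w) * sin (snd w) + cos (snd w) * cos (snd w)))%R by ring.
    rewrite E. ring.
Qed.

Lemma derive_eps_0 (f : R -> R) (l : R) : derivable_pt_lim f 0 l ->
  forall eps : R, (0 < eps)%R -> exists del : R, (0 < del)%R /\
   forall x, (Rabs x < del)%R -> (Rabs (f x - f 0 - l * x) <= eps * Rabs x)%R.
Proof.
  intros H eps He. destruct (H eps He) as [d Hd]. exists d.
  split; [apply cond_pos|]. intros x Hx.
  destruct (Req_dec x 0) as [->|N].
  - replace (f 0 - f 0 - l * 0)%R with 0%R by ring. rewrite Rabs_R0. lra.
  - specialize (Hd x N Hx). rewrite Rplus_0_l in Hd.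
    replace (f x - f 0 - l * x)%R with (((f x - f 0) / x - l) * x)%R by (field; assumption).
    rewrite Rabs_mult. apply Rmult_le_compat_r; [apply Rabs_pos|lra].
Qed.

Lemma Cdiff_Cexp_0 : Cdiff Cexp 0.
Proof.
  apply Cdiff_of_eps with (RtoC 1). intros eps He.
  (* With m the modulus of [w], the two components are bounded below by 4 e m and 5 e m, so eps / 20
     leaves room. The bounds e <= 1 and m < e make the products of errors linear in e m. *)
  set (e := Rmin 1 (eps / 20)%R).
  assert (E0 : (0 < e)%R) by (apply Rmin_pos; lra).
  assert (E1 : (e <= eps / 20)%R) by apply Rmin_r.
  assert (E2 : (e <= 1)%R) by apply Rmin_l.
  destruct (derive_eps_0 exp (exp 0) (derivable_pt_lim_exp 0) e E0) as [d1 [D1 H1]].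
  destruct (derive_eps_0 cos (- sin 0) (derivable_pt_lim_cos 0) e E0) as [d2 [D2 H2]].
  destruct (derive_eps_0 sin (cos 0) (derivable_pt_lim_sin 0) e E0) as [d3 [D3 H3]].
  rewrite exp_0 in H1. rewrite cos_0, sin_0 in H2. rewrite sin_0, cos_0 in H3.
  set (d := Rmin (Rmin d1 d2) (Rmin d3 e)).
  exists d. split. { unfold d. apply Rmin_pos; apply Rmin_pos; lra. }
  intros w Hw.
  assert (L : (Cmod (w - 0) < d1 /\ Cmod (w - 0) < d2 /\ Cmod (w - 0) < d3 /\ Cmod (w - 0) < e)%R).
  { unfold d in Hw. pose proof (Rmin_l (Rmin d1 d2) (Rmin d3 e)).
    pose proof (Rmin_r (Rmin d1 d2) (Rmin d3 e)).
    pose proof (Rmin_l d1 d2). pose proof (Rmin_r d1 d2).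
    pose proof (Rmin_l d3 e). pose proof (Rmin_r d3 e). lra. }
  replace (w - 0) with w in * by ring.
  destruct L as (L1 & L2 & L3 & L4).
  set (m := Cmod w) in *.
  destruct w as [x y].
  assert (Bx : (Rabs x <= m)%R) by apply (re_le_Cmod (x, y)).
  assert (By : (Rabs y <= m)%R) by apply (im_le_Cmod (x, y)).
  specialize (H1 x ltac:(lra)). specialize (H2 y ltac:(lra)). specialize (H3 y ltac:(lra)).
  replace (exp x - 1 - 1 * x)%R with (exp x - 1 - x)%R in H1 by ring.
  replace (cos y - 1 - - 0 * y)%R with (cos y - 1)%R in H2 by ring.
  replace (sin y - 0 - 1 * y)%R with (sin y - y)%R in H3 by ring.
  assert (F1 : (Rabs (exp x - 1 - x) <= e * m)%R) by nra.
  assert (F2 : (Rabs (cos y - 1) <= e * m)%R) by nra.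
  assert (F3 : (Rabs (sin y - y) <= e * m)%R) by nra.
  assert (M0 : (0 <= m)%R) by apply Cmod_ge_0.
  apply Rabs_le_between in F1. apply Rabs_le_between in F2. apply Rabs_le_between in F3.
  apply Rabs_le_between in Bx. apply Rabs_le_between in By.
  assert (em : (e * m <= m)%R) by nra. assert (mm : (m * m <= e * m)%R) by nra.
  assert (me : (e * m * m <= e * m)%R) by nra.
  rewrite Cexp_0.
  eapply Rle_trans; [apply Cmod_le_abs|].
  unfold Cexp; simpl fst; simpl snd.
  assert (G1 : (Rabs (exp x * cos y - 1 - x) <= 4 * (e * m))%R).
  { replace (exp x * cos y - 1 - x)%R with ((exp x - 1 - x) + exp x * (cos y - 1))%R by ring.
    assert (Ex : (Rabs (exp x) <= 3)%R) by (apply Rabs_le; lra).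
    assert (Ec : (Rabs (cos y - 1) <= e * m)%R) by (apply Rabs_le; lra).
    assert (E3 : (Rabs (exp x - 1 - x) <= e * m)%R) by (apply Rabs_le; lra).
    eapply Rle_trans; [apply Rabs_triang|]. rewrite Rabs_mult.
    pose proof (Rabs_pos (exp x)). pose proof (Rabs_pos (cos y - 1)). nra. }
  assert (G2 : (Rabs (exp x * sin y - y) <= 5 * (e * m))%R).
  { replace (exp x * sin y - y)%R with
      ((sin y - y) + (exp x - 1) * sin y)%R by ring.
    assert (Ex : (Rabs (exp x - 1) <= 2 * m)%R) by (apply Rabs_le; lra).
    assert (Ec : (Rabs (sin y) <= 2 * m)%R) by (apply Rabs_le; lra).
    assert (E3 : (Rabs (sin y - y) <= e * m)%R) by (apply Rabs_le; lra).
    eapply Rle_trans; [apply Rabs_triang|]. rewrite Rabs_mult.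
    pose proof (Rabs_pos (exp x - 1)). pose proof (Rabs_pos (sin y)). nra. }
  match goal with |- (Rabs ?a + Rabs ?b <= _)%R =>
    replace a with (exp x * cos y - 1 - x)%R by (unfold Re, RtoC; simpl; ring);
    replace b with (exp x * sin y - y)%R by (unfold Im, RtoC; simpl; ring) end.
  nra.
Qed.

Lemma Cdiff_Cexp w : Cdiff Cexp w.
Proof.
  assert (H : Cdiff (fun v => Cexp w * Cexp (v + - w)) w).
  { apply Cdiff_mult; [apply Cdiff_const|].
    apply (Cdiff_comp Cexp (fun v => v + - w)).
    - apply Cdiff_plus; [apply Cdiff_id|apply Cdiff_const].
    - replace (w + - w) with (RtoC 0) by ring. apply Cdiff_Cexp_0. }
  apply (Cdiff_ext_loc _ Cexp w 1 ltac:(lra)) in H; [exact H|].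
  intros v _. rewrite <- Cexp_plus. f_equal. ring.
Qed.

(** * Propagation of zeros inside a disc *)

(** The imaginary part of the integral of h dz around the rectangle vanishes, and periodicity
    cancels its horizontal sides. Through w -> e^w this compares integrals over concentric
    circles. *)
Lemma periodic_vertical_integral h (a b : R) : (a <= b)%R ->
  (forall x y, (a <= x <= b)%R -> Cdiff h (x, y)) ->
  (forall x, h (x, (2 * PI)%R) = h (x, 0%R)) ->
  RInt (fun y => Re (h (a, y))) 0 (2 * PI) = RInt (fun y => Re (h (b, y))) 0 (2 * PI).
Proof.
  intros Hab Hh Hp. pose proof PI_RGT_0.
  assert (E : circ (fun x y => Im (h (x, y))) (fun x y => Re (h (x, y))) a b 0 (2 * PI) = 0%R).
  { apply circ_closed_form; [assumption|lra|]. intros x y Hx Hy.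
    now apply Cdiff_closed_form, Hh. }
  unfold circ in E.
  rewrite (RInt_ext (fun x => Im (h (x, (2 * PI)%R))) (fun x => Im (h (x, 0%R)))) in E.
  2:{ intros x _. now rewrite Hp. }
  lra.
Qed.

(** The left endpoint is enough: the unit factor [u] of the next argument rotates any chosen point
    of the circle to angle 0. *)
Lemma RInt_nonneg_zero_left (f : R -> R) (b : R) : (0 < b)%R ->
  (forall x, (0 <= x <= b)%R -> continuous f x) ->
  (forall x, (0 <= x <= b)%R -> (0 <= f x)%R) ->
  RInt f 0 b = 0%R -> f 0%R = 0%R.
Proof.
  intros Hb Hc Hp HI. destruct (Rle_lt_or_eq_dec 0 (f 0%R)) as [L|E].
  { apply Hp; lra. } 2: now symmetry.
  exfalso.
  pose proof (Hc 0%R ltac:(lra)) as C0. apply filterlim_locally with (eps := mkposreal _ L) in C0.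
  destruct C0 as [d Hd]. set (m := Rmin (d / 2) b).
  pose proof (cond_pos d).
  assert (M0 : (0 < m)%R) by (apply Rmin_pos; lra).
  assert (M1 : (m <= d / 2)%R) by apply Rmin_l. assert (M2 : (m <= b)%R) by apply Rmin_r.
  assert (I1 : (0 < RInt f 0 m)%R).
  { apply RInt_gt_0; [assumption| |].
    - intros x Hx. specialize (Hd x).
      assert (Hb' : ball 0%R d x).
      { change (Rabs (x - 0) < d)%R. rewrite Rabs_right; lra. }
      specialize (Hd Hb'). change (Rabs (f x - f 0%R) < f 0%R)%R in Hd.
      apply Rabs_lt_between in Hd. lra.
    - intros x Hx. apply Hc. lra. }
  assert (I2 : (0 <= RInt f m b)%R).
  { apply RInt_ge_0; [assumption| |].
    - apply ex_RInt_cont_le; [assumption|]. intros; apply Hc; lra.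
    - intros x Hx; apply Hp; lra. }
  pose proof (RInt_Chasles (V := R_CompleteNormedModule) f 0 m b) as Ch.
  change plus with Rplus in Ch. rewrite HI in Ch.
  assert ((RInt f 0 m + RInt f m b)%R = 0%R).
  { apply Ch; apply ex_RInt_cont_le; try lra; intros; apply Hc; lra. }
  lra.
Qed.

Lemma Cmod_mul_unit_real u (r : R) : (0 <= r)%R -> Cmod u = 1%R -> Cmod (u * r) = r.
Proof. intros Hr Hu. rewrite Cmod_mult, Hu, Cmod_R, Rabs_right; lra. Qed.

(* h(w) = g(w) conj(g(2a - conj w)) with g(w) = f(z0 + u e^w) is holomorphic,
   2 pi i-periodic, equal to |g|^2 on Re w = a, and zero far enough to the left. *)
Lemma zero_propagates_circle f z0 u (r R0 rho : R) :
  (0 < r)%R -> (0 < rho)%R -> (rho ^ 2 < r * R0)%R -> Cmod u = 1%R ->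
  (forall w, (Cmod (w - z0) < R0)%R -> Cdiff f w) ->
  (forall w, (Cmod (w - z0) < r)%R -> f w = 0) ->
  f (z0 + u * rho) = 0.
Proof.
  intros Hr Hrho Hlt Hu Hd Hz.
  assert (Hmod : forall w, Cmod (z0 + u * Cexp w - z0) = exp (fst w)).
  { intros w. replace (z0 + u * Cexp w - z0) with (u * Cexp w) by ring.
    rewrite Cmod_mult, Hu, Cmod_Cexp. ring. }
  destruct (Rlt_dec rho r) as [Hs|Hs].
  { apply Hz. replace (z0 + u * rho - z0) with (u * rho) by ring.
    rewrite Cmod_mul_unit_real; lra. }
  apply Rnot_lt_le in Hs.
  assert (HR : (0 < R0)%R) by nra.
  (* A radius below [r] whose mirror image rho^2 / s in the circle of radius [rho] is still below
     [R0]; the midpoint exists because rho^2 < r R0. *)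
  set (s := ((rho ^ 2 / R0 + r) / 2)%R).
  assert (S1 : (rho ^ 2 / R0 < r)%R).
  { apply (Rmult_lt_reg_r R0); [assumption|].
    replace (rho ^ 2 / R0 * R0)%R with (rho ^ 2)%R by (field; lra). assumption. }
  assert (S2 : (rho ^ 2 / R0 < s)%R) by (unfold s; lra).
  assert (S3 : (s < r)%R) by (unfold s; lra).
  assert (S0 : (0 < s)%R).
  { assert (0 < rho ^ 2 / R0)%R; [|unfold s; lra]. apply Rdiv_lt_0_compat; nra. }
  set (a := ln rho). set (x1 := ln s).
  assert (Ea : exp a = rho) by now apply exp_ln.
  assert (E1 : exp x1 = s) by now apply exp_ln.
  assert (L : (x1 < a)%R) by (apply exp_lt_inv; lra).
  assert (RR : (rho < R0)%R) by nra.
  assert (Lx : forall x, (x <= a)%R -> (exp x < R0)%R).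
  { intros x Hx. apply Rle_lt_trans with (exp a); [|lra].
    destruct Hx as [Hx| ->]; [left; now apply exp_increasing|right; reflexivity]. }
  assert (Rx : forall x, (x1 <= x)%R -> (exp (2 * a - x) < R0)%R).
  { intros x Hx. apply Rle_lt_trans with (exp (2 * a - x1)).
    - destruct Hx as [Hx| <-]; [left; apply exp_increasing; lra|right; reflexivity].
    - replace (2 * a - x1)%R with (a + a + - x1)%R by ring.
      rewrite !exp_plus, exp_Ropp, Ea, E1.
      apply (Rmult_lt_reg_r s); [assumption|].
      replace (rho * rho * / s * s)%R with (rho ^ 2)%R by (field; lra).
      apply Rmult_lt_compat_r with (r := R0) in S2; [|assumption].
      replace (rho ^ 2 / R0 * R0)%R with (rho ^ 2)%R in S2 by (field; lra). lra. }
  set (g := fun w => f (z0 + u * Cexp w)).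
  assert (Hg : forall w, (exp (fst w) < R0)%R -> Cdiff g w).
  { intros w Hw. apply (Cdiff_comp f (fun w => z0 + u * Cexp w)).
    - apply Cdiff_plus; [apply Cdiff_const|].
      apply Cdiff_mult; [apply Cdiff_const|apply Cdiff_Cexp].
    - apply Hd. now rewrite Hmod. }
  (* [k (Cconj w)] is [g] at the mirror image of [w] in the line Re w = a; on radii the mirror is t
     -> rho^2 / t. *)
  set (k := fun w => g (RtoC (2 * a) + (- (1)) * w)).
  set (h := fun w => g w * Cconj (k (Cconj w))).
  assert (Hh : forall x y, (x1 <= x <= a)%R -> Cdiff h (x, y)).
  { intros x y Hx. apply Cdiff_mult.
    - apply Hg. simpl fst. apply Lx. lra.
    - apply (Cdiff_conj k). apply (Cdiff_comp g (fun w => RtoC (2 * a) + - (1) * w)).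
      + apply Cdiff_plus; [apply Cdiff_const|].
        apply Cdiff_mult; [apply Cdiff_const|apply Cdiff_id].
      + apply Hg. simpl.
        match goal with |- (exp ?e < _)%R => replace e with (2 * a - x)%R by ring end.
        apply Rx. lra. }
  assert (Hline : forall y, h (a, y) = g (a, y) * Cconj (g (a, y))).
  { intros y. unfold h, k. do 3 f_equal. unfold Cconj, RtoC, Cplus, Cmult, Copp; simpl.
    f_equal; ring. }
  assert (gper : forall x y, g (x, (y + 2 * PI)%R) = g (x, y)).
  { intros x y. unfold g. now rewrite Cexp_period. }
  assert (E : RInt (fun y => Re (h (x1, y))) 0 (2 * PI)
            = RInt (fun y => Re (h (a, y))) 0 (2 * PI)).
  { apply periodic_vertical_integral; [lra|assumption|]. intros x. unfold h. f_equal.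
    - rewrite <- (gper x 0%R). f_equal. f_equal. ring.
    - f_equal. unfold k.
      replace (RtoC (2 * a) + - (1) * Cconj (x, 0%R)) with ((2 * a - x)%R, (0 + 2 * PI - 2 * PI)%R)
        by (unfold Cconj, RtoC, Cplus, Cmult, Copp; simpl; f_equal; ring).
      replace (RtoC (2 * a) + - (1) * Cconj (x, (2 * PI)%R)) with ((2 * a - x)%R, (2 * PI)%R)
        by (unfold Cconj, RtoC, Cplus, Cmult, Copp; simpl; f_equal; ring).
      rewrite <- (gper _ (0 + 2 * PI - 2 * PI)%R). f_equal. f_equal. ring. }
  (* The line Re w = x1 is the circle of radius s < r, on which [f] vanishes. Hence the integral of
     |g|^2 over the period on Re w = a is 0. *)
  rewrite (RInt_ext (fun y => Re (h (x1, y))) (fun _ => 0%R)) in E.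
  2:{ intros y _. unfold h. replace (g (x1, y)) with (RtoC 0).
      - rewrite Cmult_0_l. reflexivity.
      - symmetry. apply Hz. rewrite Hmod. simpl. lra. }
  rewrite RInt_const in E. unfold scal in E.
  change (mult (2 * PI - 0)%R 0%R) with ((2 * PI - 0) * 0)%R in E.
  rewrite Rmult_0_r in E. symmetry in E.
  assert (Hsq : forall y, Re (h (a, y)) = (Cmod (g (a, y)) ^ 2)%R).
  { intros y. rewrite Hline, <- Cmod2_conj. reflexivity. }
  apply RInt_nonneg_zero_left in E.
  - rewrite Hsq in E.
    assert (Z : g (a, 0%R) = 0).
    { apply Cmod_eq_0. pose proof (Cmod_ge_0 (g (a, 0%R))). nra. }
    unfold g in Z. rewrite <- Z. do 2 f_equal. unfold Cexp; simpl.
    rewrite Ea, cos_0, sin_0. unfold RtoC. f_equal. f_equal; ring.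
  - pose proof PI_RGT_0; lra.
  - intros y _. destruct (Cdiff_closed_form h a y (Hh a y ltac:(lra))) as (p & s' & q & _ & F).
    exact (frechet2_continuous_l _ _ _ _ _ (frechet2_swap _ _ _ _ _ F)).
  - intros y _. rewrite Hsq. apply pow2_ge_0.
Qed.

Lemma zero_propagates_step f z0 (r R0 : R) w :
  (0 < r)%R -> (Cmod (w - z0) ^ 2 < r * R0)%R ->
  (forall w, (Cmod (w - z0) < R0)%R -> Cdiff f w) ->
  (forall w, (Cmod (w - z0) < r)%R -> f w = 0) ->
  f w = 0.
Proof.
  intros Hr Hw Hd Hz.
  destruct (Req_dec (Cmod (w - z0)) 0) as [E|N].
  { apply Hz. lra. }
  pose proof (Cmod_ge_0 (w - z0)) as P.
  assert (N' : RtoC (Cmod (w - z0)) <> 0).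
  { intros H. apply RtoC_inj in H. contradiction. }
  rewrite <- (zero_propagates_circle f z0 ((w - z0) / Cmod (w - z0)) r R0 (Cmod (w - z0)));
    try assumption; try lra.
  - f_equal. field. assumption.
  - rewrite Cmod_div by assumption. rewrite Cmod_R, Rabs_right by lra. field. assumption.
Qed.

(** Let S be the supremum of the radii up to R0 within which [f] vanishes. One propagation step
    reaches sqrt (S R0), which exceeds S unless S = R0. *)
Lemma holomorphic_zero_ball f z0 (r R0 : R) :
  (0 < r)%R ->
  (forall w, (Cmod (w - z0) < R0)%R -> Cdiff f w) ->
  (forall w, (Cmod (w - z0) < r)%R -> f w = 0) ->
  forall w, (Cmod (w - z0) < R0)%R -> f w = 0.
Proof.
  intros Hr Hd Hz.
  destruct (Rle_dec R0 r) as [L|L].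
  { intros w Hw. apply Hz. lra. }
  set (E := fun s => (s <= R0)%R /\ forall w, (Cmod (w - z0) < s)%R -> f w = 0).
  destruct (completeness E) as [S [HS1 HS2]].
  - exists R0. intros s [Hs _]. exact Hs.
  - exists r. split; [lra|assumption].
  - assert (Sr : (r <= S)%R) by (apply HS1; split; [lra|assumption]).
    assert (SR : (S <= R0)%R) by (apply HS2; intros s [Hs _]; exact Hs).
    assert (ZS : forall w, (Cmod (w - z0) < S)%R -> f w = 0).
    { intros w Hw. apply NNPP. intros N.
      assert (S <= Cmod (w - z0))%R; [|lra]. apply HS2. intros s [_ Hs].
      apply Rnot_lt_le. intros K. apply N, Hs, K. }
    destruct SR as [SR| ->]; [|exact ZS].
    exfalso. assert (sqrt (S * R0) <= S)%R.
    { apply HS1. split.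
      - rewrite <- (sqrt_square R0) at 2 by lra.
        apply sqrt_le_1; [apply Rmult_le_pos; lra|apply Rmult_le_pos; lra|apply Rmult_le_compat_r; lra].
      - intros w Hw. apply (zero_propagates_step f z0 S R0); try assumption; [lra|].
        assert (Q : (0 <= S * R0)%R) by (apply Rmult_le_pos; lra).
        rewrite <- (pow2_sqrt (S * R0)) by exact Q.
        pose proof (Cmod_ge_0 (w - z0)). pose proof (sqrt_pos (S * R0)). nra. }
    assert (S < sqrt (S * R0))%R; [|lra].
    rewrite <- (sqrt_square S) at 1 by lra.
    apply sqrt_lt_1; [apply Rmult_le_pos; lra|apply Rmult_le_pos; lra|apply Rmult_lt_compat_l; lra].
Qed.

(** * The identity theorem for meromorphic functions on C^* *)

Lemma Cpw_pow z n : Cpw z n = z ^ n.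
Proof.
  induction n; [reflexivity|].
  change (Cpw z (S n)) with (z * Cpw z n). now rewrite IHn, Cpow_S.
Qed.

Lemma Cmult_integral (a b : C) : a * b = 0 -> a = 0 \/ b = 0.
Proof.
  intros H. apply (f_equal Cmod) in H. rewrite Cmod_mult, Cmod_0 in H.
  apply Rmult_integral in H. destruct H; [left|right]; now apply Cmod_eq_0.
Qed.

Lemma Cmod_triangle_sub a b c : (Cmod (a - c) <= Cmod (a - b) + Cmod (b - c))%R.
Proof. replace (a - c) with ((a - b) + (b - c)) by ring. apply Cmod_triangle. Qed.

Lemma Cmod_sub_sym a b : Cmod (a - b) = Cmod (b - a).
Proof. rewrite <- Cmod_opp. f_equal. ring. Qed.

Lemma Cmod_sub_gt_0 a b : a <> b -> (0 < Cmod (a - b))%R.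
Proof.
  intros H. apply Cmod_gt_0. intros Z. apply H.
  rewrite <- (Cplus_0_l b), <- Z. ring.
Qed.

Lemma Cmod_sub_diag a : Cmod (a - a) = 0%R.
Proof. replace (a - a) with (RtoC 0) by ring. apply Cmod_0. Qed.

Lemma Ccont_pow_sub p n z : Ccont (fun w => (w - p) ^ n) z.
Proof.
  induction n.
  - exact (Ccont_const 1 z).
  - apply (Ccont_mult (fun w => w + - p) (fun w => (w - p) ^ n)); [|exact IHn].
    apply Ccont_plus; [apply Ccont_id|apply Ccont_const].
Qed.

Lemma Cdiff_pow_sub p n z : Cdiff (fun w => (w - p) ^ n) z.
Proof.
  induction n.
  - exact (Cdiff_const 1 z).
  - apply (Cdiff_mult (fun w => w + - p) (fun w => (w - p) ^ n)); [|exact IHn].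
    apply Cdiff_plus; [apply Cdiff_id|apply Cdiff_const].
Qed.

(* The extra factor (w - p)^2 makes the product differentiable at p itself,
   whatever the junk value f p is. *)
Lemma pole_clear f p m L :
  filterlim (fun w => Cpw (w - p) m * f w) (@locally' C_UniformSpace p)
            (@locally C_UniformSpace L) ->
  Cdiff (fun w => (w - p) ^ S (S m) * f w) p.
Proof.
  intros H.
  (* One of the two extra factors is the increment [w - p]. The other makes this slope, otherwise
     bounded near [p], tend to its value 0 at [p]. *)
  exists (fun w => (w - p) * ((w - p) ^ m * f w)). split.
  - assert (HL : @locally C_UniformSpace L (fun v => (Cmod v < Cmod L + 3)%R)).
    { exists (mkposreal 1 ltac:(lra)). intros v [B1 B2].
      change (Rabs (fst v - fst L) < 1)%R in B1. change (Rabs (snd v - snd L) < 1)%R in B2.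
      replace v with ((v - L) + L) by ring.
      eapply Rle_lt_trans; [apply Cmod_triangle|].
      pose proof (Cmod_le_abs (v - L)) as K.
      change (Re (v - L)) with (fst v - fst L)%R in K.
      change (Im (v - L)) with (snd v - snd L)%R in K. lra. }
    specialize (H _ HL). destruct H as [d Hd].
    intros eps He. pose proof (Cmod_ge_0 L).
    exists (Rmin d (eps / (Cmod L + 3))). split.
    { apply Rmin_pos; [apply cond_pos|apply Rdiv_lt_0_compat; lra]. }
    intros w Hw. pose proof (Rmin_l d (eps / (Cmod L + 3))).
    pose proof (Rmin_r d (eps / (Cmod L + 3))).
    match goal with |- (Cmod (?a - ?b) < _)%R => replace (a - b) with a by ring end.
    rewrite Cmod_mult.
    destruct (classic (w = p)) as [->|N].
    { rewrite Cmod_sub_diag. lra. }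
    assert (B : @ball C_UniformSpace p d w).
    { apply C_NormedModule_mixin_compat1. change (Cmod (w - p) < d)%R. lra. }
    specialize (Hd w B N). rewrite Cpw_pow in Hd.
    pose proof (Cmod_sub_gt_0 w p N).
    apply Rlt_trans with (Cmod (w - p) * (Cmod L + 3))%R.
    + apply Rmult_lt_compat_l; assumption.
    + apply Rlt_le_trans with (eps / (Cmod L + 3) * (Cmod L + 3))%R.
      * apply Rmult_lt_compat_r; lra.
      * right. field. lra.
  - intros w. rewrite !Cpow_S. ring.
Qed.

Lemma meromorphic_regular_punctured f (z : C) : meromorphic_Cstar f -> z <> 0 ->
  exists r : R, (0 < r)%R /\ forall w, (0 < Cmod (w - z) < r)%R -> w <> 0 /\ Cdiff f w.
Proof.
  intros (P & [HP0 HP] & HD & _) Hz.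
  destruct (HP z Hz) as [r [Hr Hw]].
  pose proof (proj1 (Cmod_gt_0 z) Hz).
  exists (Rmin r (Cmod z)). split; [now apply Rmin_pos|]. intros w [W1 W2].
  pose proof (Rmin_l r (Cmod z)). pose proof (Rmin_r r (Cmod z)).
  assert (N : w <> 0).
  { intros ->. rewrite Cmod_sub_sym in W2. replace (z - 0) with z in W2 by ring. lra. }
  split; [assumption|]. apply ex_derive_Cdiff, HD; [assumption|]. apply Hw; lra.
Qed.

Lemma meromorphic_local f (z : C) : meromorphic_Cstar f -> z <> 0 ->
  exists (m : nat) (r : R), (0 < r)%R /\
    forall w, (Cmod (w - z) < r)%R -> Cdiff (fun v => (v - z) ^ m * f v) w.
Proof.
  intros Hf Hz. destruct (meromorphic_regular_punctured f z Hf Hz) as [r [Hr Hw]].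
  destruct Hf as (P & _ & HD & HL).
  assert (E : exists m, Cdiff (fun v => (v - z) ^ m * f v) z).
  { destruct (classic (P z)) as [p|n].
    - destruct (HL z p) as (m & L & H). exists (S (S m)). now apply pole_clear with L.
    - exists O. apply Cdiff_mult; [apply Cdiff_pow_sub|].
      apply ex_derive_Cdiff. now apply HD. }
  destruct E as [m Hm]. exists m, r. split; [assumption|]. intros w W.
  destruct (classic (w = z)) as [->|N]; [assumption|].
  apply Cdiff_mult; [apply Cdiff_pow_sub|]. apply Hw. split; [|assumption].
  now apply Cmod_sub_gt_0.
Qed.

(** The point itself is left out because [f z] may be a junk value at a pole. *)
Definition zero_near (f : C -> C) (z : C) : Prop :=
  exists r : R, (0 < r)%R /\ forall w, (0 < Cmod (w - z) < r)%R -> f w = 0.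

Definition zero_ball (f : C -> C) (z : C) (r : R) : Prop :=
  forall w, (Cmod (w - z) < r)%R -> f w = 0.

Lemma zero_near_open f z : zero_near f z -> exists r : R, (0 < r)%R /\
  forall w, (Cmod (w - z) < r)%R -> zero_near f w.
Proof.
  intros [r [Hr H]]. exists r. split; [assumption|]. intros w Hw.
  destruct (classic (w = z)) as [->|N].
  { now exists r. }
  pose proof (Cmod_sub_gt_0 w z N).
  exists (Rmin (Cmod (w - z)) (r - Cmod (w - z))). split; [apply Rmin_pos; lra|].
  intros v Hv. pose proof (Rmin_l (Cmod (w - z)) (r - Cmod (w - z))).
  pose proof (Rmin_r (Cmod (w - z)) (r - Cmod (w - z))).
  apply H. pose proof (Cmod_triangle_sub v w z). pose proof (Cmod_triangle_sub w v z).
  rewrite (Cmod_sub_sym w v) in *. lra.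
Qed.

Lemma zero_near_ball f z (d : R) : zero_near f z -> (0 < d)%R ->
  exists z' (s : R), (0 < s)%R /\ (Cmod (z' - z) < d)%R /\ zero_ball f z' s.
Proof.
  intros [r [Hr H]] Hd. set (e := (Rmin r d / 4)%R).
  assert (E : (0 < Rmin r d)%R) by now apply Rmin_pos.
  pose proof (Rmin_l r d). pose proof (Rmin_r r d).
  assert (K : Cmod (z + RtoC e - z) = e).
  { replace (z + RtoC e - z) with (RtoC e) by ring.
    rewrite Cmod_R, Rabs_right; [reflexivity|unfold e; lra]. }
  exists (z + RtoC e), e. split; [unfold e; lra|]. split.
  - rewrite K. unfold e; lra.
  - intros w Hw. apply H.
    pose proof (Cmod_triangle_sub w (z + RtoC e) z).
    pose proof (Cmod_triangle_sub (z + RtoC e) w z).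
    rewrite (Cmod_sub_sym (z + RtoC e) w) in *. rewrite K in *. unfold e in *. lra.
Qed.

(** The ball of radius r / 2 around [z1] contains [z] and stays in the ball where the pole-cleared
    function is holomorphic. Zeros spread through it, and away from [z] the clearing factor can be
    divided out. *)
Lemma zero_ball_near f z z1 (m : nat) (r s : R) :
  (0 < s)%R -> (Cmod (z1 - z) < r / 2)%R ->
  (forall w, (Cmod (w - z) < r)%R -> Cdiff (fun v => (v - z) ^ m * f v) w) ->
  zero_ball f z1 s -> zero_near f z.
Proof.
  intros Hs Hz1 Hd Hz. pose proof (Cmod_ge_0 (z1 - z)).
  assert (K : forall w, (Cmod (w - z1) < r / 2)%R -> (w - z) ^ m * f w = 0).
  { apply (holomorphic_zero_ball (fun w => (w - z) ^ m * f w) z1 s).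
    - assumption.
    - intros w Hw. apply Hd. pose proof (Cmod_triangle_sub w z1 z). lra.
    - intros w Hw. rewrite (Hz w Hw). ring. }
  exists (r / 2 - Cmod (z1 - z))%R. split; [lra|]. intros w Hw.
  assert (Hk : (w - z) ^ m * f w = 0).
  { apply K. pose proof (Cmod_triangle_sub w z z1). rewrite (Cmod_sub_sym z z1) in *. lra. }
  apply Cmult_integral in Hk. destruct Hk as [Hk|Hk]; [|assumption].
  exfalso. revert Hk. apply Cpow_nz. apply Cmod_gt_0. lra.
Qed.

(** A connectedness argument on [0, 1]: [zero_near] is an open condition, and it passes to the
    supremum because [f] becomes holomorphic near every point of the segment after multiplication by
    a power. *)
Lemma zero_near_segment f a b : meromorphic_Cstar f ->
  (forall t : R, (0 <= t <= 1)%R -> a + RtoC t * (b - a) <> 0) ->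
  zero_near f a -> zero_near f b.
Proof.
  intros Hf Hn Ha. set (g := fun t : R => a + RtoC t * (b - a)) in *.
  set (M := (Cmod (b - a) + 1)%R).
  assert (HM : (0 < M)%R) by (unfold M; pose proof (Cmod_ge_0 (b - a)); lra).
  assert (Lip : forall t s d : R, (Rabs (t - s) < d / M)%R -> (Cmod (g t - g s) < d)%R).
  { intros t s d Hts. unfold g.
    replace (a + RtoC t * (b - a) - (a + RtoC s * (b - a))) with (RtoC (t - s) * (b - a))
      by (rewrite RtoC_minus; ring).
    rewrite Cmod_mult, Cmod_R.
    apply Rmult_lt_compat_r with (r := M) in Hts; [|assumption].
    replace (d / M * M)%R with d in Hts by (field; lra).
    pose proof (Rabs_pos (t - s)). unfold M in Hts. nra. }
  set (T := fun t => (0 <= t <= 1)%R /\ forall s, (0 <= s <= t)%R -> zero_near f (g s)).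
  assert (T0 : T 0%R).
  { split; [lra|]. intros s Hs. replace s with 0%R by lra. unfold g.
    replace (a + RtoC 0 * (b - a)) with a by ring. assumption. }
  destruct (completeness T) as [x [X1 X2]].
  { exists 1%R. intros t [Ht _]. lra. } { now exists 0%R. }
  assert (Hx : (0 <= x <= 1)%R).
  { split; [now apply X1|]. apply X2. intros t [Ht _]; lra. }
  assert (Below : forall s, (0 <= s < x)%R -> zero_near f (g s)).
  { intros s Hs. apply NNPP. intros N. assert (x <= s)%R; [|lra].
    apply X2. intros t [_ Ht]. apply Rnot_lt_le. intros K. apply N, Ht. lra. }
  assert (Zx : zero_near f (g x)).
  { destruct (meromorphic_local f (g x) Hf (Hn x Hx)) as (m & r & Hr & Hd).
    destruct (Rle_lt_or_eq_dec 0 x ltac:(lra)) as [P|<-].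
    2:{ apply T0. lra. }
    (* A parameter slightly before [x] costs r / 4 in distance, and the centre of its zero ball
       another r / 4, within the r / 2 that [zero_ball_near] allows. *)
    assert (Q : (0 < r / 4 / M)%R) by (apply Rdiv_lt_0_compat; lra).
    set (s := Rmax 0 (x - r / 4 / M / 2)).
    assert (S1 : (0 <= s < x)%R).
    { split; [apply Rmax_l|]. apply Rmax_lub_lt; lra. }
    assert (S2 : (Rabs (s - x) < r / 4 / M)%R).
    { pose proof (Rmax_r 0 (x - r / 4 / M / 2)). fold s in H. rewrite Rabs_left; lra. }
    apply Lip in S2.
    destruct (zero_near_ball f (g s) (r / 4) (Below s S1) ltac:(lra)) as (z' & e & He & Hz' & Hb).
    apply (zero_ball_near f (g x) z' m r e); try assumption.
    pose proof (Cmod_triangle_sub z' (g s) (g x)). lra. }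
  destruct (Rle_lt_or_eq_dec x 1 ltac:(lra)) as [L|E].
  2:{ subst x. replace b with (g 1%R) by (unfold g; ring). assumption. }
  exfalso. destruct (zero_near_open f _ Zx) as [r [Hr Ho]].
  assert (Q : (0 < r / M)%R) by (apply Rdiv_lt_0_compat; lra).
  set (y := Rmin 1 (x + r / M / 2)).
  assert (Y1 : (x < y)%R) by (apply Rmin_glb_lt; lra).
  assert (Y2 : (y <= 1)%R) by apply Rmin_l.
  assert (Y3 : (y <= x + r / M / 2)%R) by apply Rmin_r.
  assert (T y) by (split; [lra|]; intros s Hs;
    destruct (Rlt_le_dec s x); [apply Below; lra|]; apply Ho, Lip;
    rewrite Rabs_right; lra).
  specialize (X1 y H). lra.
Qed.

Lemma zero_near_everywhere f (a z : C) : meromorphic_Cstar f ->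
  a <> 0 -> zero_near f a -> z <> 0 -> zero_near f z.
Proof.
  intros Hf Ha Za Hz.
  destruct (classic (exists t : R, (0 <= t <= 1)%R /\ a + RtoC t * (z - a) = 0))
    as [(t & Ht & E)|N].
  2:{ apply (zero_near_segment f a z Hf); [|assumption]. intros t Ht K. apply N. now exists t. }
  (* If the segment from [a] to [z] meets 0, then [z] is a negative real multiple of [a]; the detour
     through [Ci * a] avoids 0 on both pieces. *)
  apply (zero_near_segment f (Ci * a) z Hf).
  - intros s Hs K.
    assert (Et : RtoC t * z = - (RtoC (1 - t) * a)).
    { rewrite RtoC_minus. transitivity (a + RtoC t * (z - a) - (1 - RtoC t) * a); [ring|].
      rewrite E. ring. }
    assert (Et2 : (RtoC (t * (1 - s)) * Ci - RtoC (s * (1 - t))) * a = 0).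
    { rewrite !RtoC_mult.
      transitivity (RtoC t * (Ci * a + RtoC s * (z - Ci * a))).
      - transitivity (RtoC t * RtoC (1 - s) * Ci * a + RtoC s * (RtoC t * z)).
        + rewrite Et. ring.
        + rewrite RtoC_minus. ring.
      - rewrite K. ring. }
    apply Cmult_integral in Et2. destruct Et2 as [Et2|Et2]; [|contradiction].
    assert (I1 : (t * (1 - s))%R = 0%R).
    { apply (f_equal snd) in Et2. unfold RtoC, Ci, Cmult, Cminus, Cplus, Copp in Et2.
      simpl in Et2. lra. }
    assert (Ht0 : t <> 0%R).
    { intros ->. apply Ha. rewrite <- E. ring. }
    assert (Es : s = 1%R).
    { apply Rmult_integral in I1. destruct I1; [contradiction|lra]. }
    subst s. apply Hz. rewrite <- K. ring.
  - apply (zero_near_segment f a (Ci * a) Hf); [|assumption]. intros s Hs K.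
    assert (K2 : (RtoC (1 - s) + RtoC s * Ci) * a = 0).
    { rewrite <- K, RtoC_minus. ring. }
    apply Cmult_integral in K2. destruct K2 as [K2|K2]; [|contradiction].
    pose proof (f_equal fst K2) as K3. pose proof (f_equal snd K2) as K4.
    unfold RtoC, Ci, Cmult, Cplus in K3, K4. simpl in K3, K4. lra.
Qed.

Lemma nonzero_subball (z : C) (r : R) : (0 < r)%R ->
  exists (z' : C) (r' : R), (0 < r')%R /\ z' <> 0 /\
   forall w, (Cmod (w - z') < r')%R -> (Cmod (w - z) < r)%R.
Proof.
  intros Hr. destruct (classic (z = 0)) as [->|N].
  - exists (RtoC (r / 2)), (r / 2)%R. repeat split; [lra| |].
    + intros K. apply RtoC_inj in K. lra.
    + intros w Hw. pose proof (Cmod_triangle_sub w (RtoC (r / 2)) 0) as T.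
      replace (RtoC (r / 2) - 0) with (RtoC (r / 2)) in T by ring.
      rewrite Cmod_R, Rabs_right in T; lra.
  - now exists z, r.
Qed.

Theorem meromorphic_identity f z (r : R) : meromorphic_Cstar f ->
  (0 < r)%R -> zero_ball f z r -> mer_eq f (fun _ => 0).
Proof.
  intros Hf Hr Hz.
  destruct (nonzero_subball z r Hr) as (a & s & Hs & Ha & Hsub).
  assert (Za : zero_near f a).
  { exists s. split; [assumption|]. intros w Hw. apply Hz, Hsub. lra. }
  (* The exceptional set is the set of all nonzero values of [f]; [zero_near] at every point of C^*
     is exactly its discreteness. *)
  exists (fun w : C => w <> 0 /\ f w <> 0). split.
  - split; [tauto|]. intros w Hw.
    destruct (zero_near_everywhere f a w Hf Ha Za Hw) as [e [He H]].
    exists e. split; [assumption|]. intros v V1 V2 [_ K]. apply K, H. lra.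
  - intros w Hw N. apply NNPP. intros K. apply N. now split.
Qed.

Lemma punctured_subball (z : C) (r : R) : (0 < r)%R ->
  exists z' (r' : R), (0 < r')%R /\
   forall w, (Cmod (w - z') < r')%R -> (0 < Cmod (w - z) < r)%R.
Proof.
  intros Hr.
  assert (K : Cmod (z + RtoC (r / 2) - z) = (r / 2)%R).
  { replace (z + RtoC (r / 2) - z) with (RtoC (r / 2)) by ring.
    rewrite Cmod_R, Rabs_right; lra. }
  exists (z + RtoC (r / 2)), (r / 2)%R. split; [lra|]. intros w Hw.
  pose proof (Cmod_triangle_sub w (z + RtoC (r / 2)) z).
  pose proof (Cmod_triangle_sub (z + RtoC (r / 2)) w z).
  rewrite (Cmod_sub_sym (z + RtoC (r / 2)) w) in *. lra.
Qed.

(** By the identity theorem [f] cannot vanish on a whole ball of regular points; a nonzero value at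
    a regular point spreads by continuity. *)
Lemma meromorphic_nonvanishing_subball f z (r : R) : meromorphic_Cstar f ->
  ~ mer_eq f (fun _ => 0) -> (0 < r)%R ->
  exists z' (r' : R), (0 < r')%R /\
   forall w, (Cmod (w - z') < r')%R -> (Cmod (w - z) < r)%R /\ w <> 0 /\ f w <> 0.
Proof.
  intros Hf Hn Hr.
  destruct (nonzero_subball z r Hr) as (a & s & Hs & Ha & Hsub).
  destruct (meromorphic_regular_punctured f a Hf Ha) as (e & He & Hreg).
  destruct (punctured_subball a (Rmin s e)) as (b & d & Hd & Hb); [now apply Rmin_pos|].
  pose proof (Rmin_l s e). pose proof (Rmin_r s e).
  destruct (classic (zero_ball f b d)) as [Z|Z].
  { exfalso. now apply Hn, (meromorphic_identity f b d). }
  apply not_all_ex_not in Z. destruct Z as [c Hc].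
  apply imply_to_and in Hc. destruct Hc as [Hc1 Hc2].
  pose proof (Hb c Hc1) as Hc3.
  destruct (Hreg c ltac:(lra)) as [_ Hdc].
  destruct (Ccont_neq0 f c (Cdiff_cont _ _ Hdc) Hc2) as (u & Hu & Hcu).
  exists c, (Rmin u (d - Cmod (c - b))). split; [apply Rmin_pos; lra|]. intros w Hw.
  pose proof (Rmin_l u (d - Cmod (c - b))). pose proof (Rmin_r u (d - Cmod (c - b))).
  pose proof (Cmod_triangle_sub w c b).
  pose proof (Hb w ltac:(lra)) as Hwb.
  repeat split.
  - apply Hsub. lra.
  - apply Hreg. lra.
  - apply Hcu. lra.
Qed.

(* Cpw and Cpow unify up to conversion, so rewriting with Cpw_pow under ! stops early. *)
Ltac to_Cpow :=
  repeat match goal with |- context [Cpw ?a ?n] => change (Cpw a n) with (Cpow a n) end.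

(** * Finite sums and absolutely convergent series of complex numbers *)

Fixpoint Csum (f : nat -> C) (n : nat) : C :=
  match n with O => 0 | S m => Csum f m + f m end.

Lemma Csum_ext f g n : (forall k, (k < n)%nat -> f k = g k) -> Csum f n = Csum g n.
Proof.
  intros H. induction n; [reflexivity|]. simpl. rewrite IHn, H; auto.
Qed.

Lemma Csum_plus f g n : Csum (fun k => f k + g k) n = Csum f n + Csum g n.
Proof. induction n; simpl; [ring|]. rewrite IHn. ring. Qed.

Lemma Csum_scal c f n : Csum (fun k => c * f k) n = c * Csum f n.
Proof. induction n; simpl; [ring|]. rewrite IHn. ring. Qed.

Lemma Csum_const c n : Csum (fun _ => c) n = RtoC (INR n) * c.
Proof. induction n; [simpl; ring|]. simpl Csum. rewrite IHn, S_INR, RtoC_plus. ring. Qed.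

Lemma Csum_0 n : Csum (fun _ => 0) n = 0.
Proof. rewrite Csum_const. ring. Qed.

Lemma Csum_exchange (f : nat -> nat -> C) n m :
  Csum (fun i => Csum (f i) m) n = Csum (fun j => Csum (fun i => f i j) n) m.
Proof.
  induction n; simpl.
  - symmetry. apply Csum_0.
  - rewrite IHn. symmetry. apply Csum_plus.
Qed.

Lemma Csum_Sn_l f n : Csum f (S n) = f O + Csum (fun k => f (S k)) n.
Proof.
  induction n; [simpl; ring|]. change (Csum f (S (S n))) with (Csum f (S n) + f (S n)).
  rewrite IHn. simpl. ring.
Qed.

Lemma Csum_Cmod_lt f n (B : R) : (0 < n)%nat ->
  (forall k, (k < n)%nat -> (Cmod (f k) < B)%R) -> (Cmod (Csum f n) < INR n * B)%R.
Proof.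
  intros Hn H. induction n; [lia|]. destruct n.
  - simpl. replace (0 + f O) with (f O) by ring. specialize (H O ltac:(lia)). lra.
  - rewrite S_INR. change (Csum f (S (S n))) with (Csum f (S n) + f (S n)).
    eapply Rle_lt_trans; [apply Cmod_triangle|].
    specialize (IHn ltac:(lia) ltac:(auto)). specialize (H (S n) ltac:(lia)). lra.
Qed.

Lemma Ccont_Csum (f : nat -> C -> C) n z : (forall k, Ccont (f k) z) ->
  Ccont (fun w => Csum (fun k => f k w) n) z.
Proof.
  intros H. induction n.
  - exact (Ccont_const 0 z).
  - simpl. now apply Ccont_plus.
Qed.

Definition Csummable (a : nat -> C) : Prop := ex_series (fun n => Cmod (a n)).

Lemma ex_series_le_R (a b : nat -> R) :
  (forall n, (Rabs (a n) <= b n)%R) -> ex_series b -> ex_series a.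
Proof. exact (@ex_series_le R_AbsRing R_CompleteNormedModule a b). Qed.

Lemma Csummable_le a (A : nat -> R) :
  (forall n, (Cmod (a n) <= A n)%R) -> ex_series A -> Csummable a.
Proof.
  intros H HA. apply ex_series_le_R with A; [|assumption].
  intros n. rewrite Rabs_right; [apply H|apply Rle_ge, Cmod_ge_0].
Qed.

Lemma Csummable_Re a : Csummable a -> ex_series (fun n => Re (a n)).
Proof. apply ex_series_le_R. intros n. apply re_le_Cmod. Qed.

Lemma Csummable_Im a : Csummable a -> ex_series (fun n => Im (a n)).
Proof. apply ex_series_le_R. intros n. apply im_le_Cmod. Qed.

Lemma Csummable_S a : Csummable a -> Csummable (fun n => a (S n)).
Proof. intros H. apply (ex_series_incr_1 (fun n => Cmod (a n))) in H. exact H. Qed.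

Lemma Csummable_shift a M : Csummable a -> Csummable (fun n => a (M + n)%nat).
Proof. intros H. apply (ex_series_incr_n (fun n => Cmod (a n)) M) in H. exact H. Qed.

Lemma CSeries_ext a b : (forall n, a n = b n) -> CSeries a = CSeries b.
Proof.
  intros H. unfold CSeries.
  rewrite (Series_ext (fun n => Re (a n)) (fun n => Re (b n))),
    (Series_ext (fun n => Im (a n)) (fun n => Im (b n))); [reflexivity|..];
    intros n; now rewrite H.
Qed.

Lemma Cdecomp z : z = RtoC (Re z) + Ci * RtoC (Im z).
Proof. destruct z. unfold Re, Im, RtoC, Ci, Cplus, Cmult; simpl. f_equal; ring. Qed.

Lemma CSeries_incr_1 a : Csummable a -> CSeries a = a O + CSeries (fun n => a (S n)).
Proof.
  intros H. unfold CSeries.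
  rewrite (Series_incr_1 _ (Csummable_Re a H)), (Series_incr_1 _ (Csummable_Im a H)).
  rewrite !RtoC_plus. rewrite (Cdecomp (a O)) at 3. ring.
Qed.

Lemma CSeries_shift a M : Csummable a ->
  CSeries a = Csum a M + CSeries (fun n => a (M + n)%nat).
Proof.
  intros H. induction M.
  - simpl. rewrite Cplus_0_l. now apply CSeries_ext.
  - rewrite IHM, (CSeries_incr_1 (fun n => a (M + n)%nat)) by now apply Csummable_shift.
    simpl Csum. rewrite Nat.add_0_r, Cplus_assoc. f_equal.
    apply CSeries_ext. intros n. f_equal. lia.
Qed.

Lemma CSeries_scal c a : Csummable a -> CSeries (fun n => c * a n) = c * CSeries a.
Proof.
  intros H. pose proof (Csummable_Re a H) as H1. pose proof (Csummable_Im a H) as H2.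
  destruct c as [c1 c2]. unfold CSeries.
  rewrite (Series_ext (fun n => Re ((c1, c2) * a n)) (fun n => c1 * Re (a n) - c2 * Im (a n))%R)
    by (intros; apply re_mult).
  rewrite (Series_ext (fun n => Im ((c1, c2) * a n)) (fun n => c1 * Im (a n) + c2 * Re (a n))%R)
    by (intros; apply im_mult).
  rewrite Series_minus, Series_plus, !Series_scal_l;
    try (apply (ex_series_scal_l (V := R_NormedModule)); assumption).
  set (A := Series (fun n => Re (a n))). set (B := Series (fun n => Im (a n))).
  unfold RtoC, Ci, Cplus, Cmult; simpl. f_equal; ring.
Qed.

(** [CSeries] is assembled from real and imaginary parts; bounding each by [Series A] costs the
    factor 2. *)
Lemma CSeries_bound a (A : nat -> R) :
  (forall n, (Cmod (a n) <= A n)%R) -> ex_series A -> (Cmod (CSeries a) <= 2 * Series A)%R.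
Proof.
  intros H HA.
  assert (K : forall u : nat -> R, (forall n, (Rabs (u n) <= Cmod (a n))%R) ->
     (Rabs (Series u) <= Series A)%R).
  { intros u Hu. eapply Rle_trans; [apply Series_Rabs|apply Series_le].
    - apply ex_series_le_R with A; [|assumption]. intros n. rewrite Rabs_Rabsolu.
      eapply Rle_trans; [apply Hu|apply H].
    - intros n. split; [apply Rabs_pos|]. eapply Rle_trans; [apply Hu|apply H].
    - assumption. }
  unfold CSeries. eapply Rle_trans; [apply Cmod_triangle|].
  rewrite Cmod_mult, Cmod_Ci, !Cmod_R.
  pose proof (K (fun n => Re (a n)) ltac:(intros; apply re_le_Cmod)).
  pose proof (K (fun n => Im (a n)) ltac:(intros; apply im_le_Cmod)). lra.
Qed.

Lemma Series_tail_small (A : nat -> R) (eps : R) : ex_series A -> (0 < eps)%R ->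
  exists M0, forall M, (M0 <= M)%nat -> (Series (fun n => A (M + n)%nat) < eps)%R.
Proof.
  intros HA He.
  pose proof (Series_correct A HA) as L.
  apply (is_lim_seq_spec (sum_n A) (Series A)) in L.
  destruct (L (mkposreal eps He)) as [M0 HM]. exists (S M0). intros M HMM.
  destruct M as [|M]; [lia|]. specialize (HM M ltac:(lia)). simpl in HM.
  rewrite (Series_incr_n A (S M)) in HM by (assumption || lia). simpl Nat.pred in HM.
  rewrite <- sum_n_Reals in HM. apply Rabs_lt_between in HM. lra.
Qed.

Lemma Ccont_CSeries (f : nat -> C -> C) (A : nat -> R) z (r : R) :
  (0 < r)%R -> ex_series A -> (forall n, Ccont (f n) z) ->
  (forall w n, (Cmod (w - z) < r)%R -> (Cmod (f n w) <= A n)%R) ->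
  Ccont (fun w => CSeries (fun n => f n w)) z.
Proof.
  intros Hr HA Hf Hb eps He.
  (* One eps / 6 for the partial sums and 2 eps / 6 for each of the two tails add up to less than
     eps. *)
  destruct (Series_tail_small A (eps / 6) HA ltac:(lra)) as [M HM].
  specialize (HM M (le_n M)).
  destruct (Ccont_Csum f M z Hf (eps / 6)%R ltac:(lra)) as [d [Hd Hc]].
  exists (Rmin d r). split; [now apply Rmin_pos|]. intros w Hw.
  pose proof (Rmin_l d r). pose proof (Rmin_r d r).
  assert (Bd : forall v, (Cmod (v - z) < r)%R ->
     CSeries (fun n => f n v) = Csum (fun n => f n v) M + CSeries (fun n => f (M + n)%nat v)
     /\ (Cmod (CSeries (fun n => f (M + n)%nat v)) <= 2 * (eps / 6))%R).
  { intros v Hv. split.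
    - apply (CSeries_shift (fun n => f n v)). apply Csummable_le with A; auto.
    - eapply Rle_trans; [apply (CSeries_bound _ (fun n => A (M + n)%nat))|].
      + intros n. now apply Hb.
      + apply (ex_series_incr_n A M). assumption.
      + lra. }
  destruct (Bd w ltac:(lra)) as [-> B1].
  destruct (Bd z ltac:(rewrite Cmod_sub_diag; lra)) as [-> B2].
  specialize (Hc w ltac:(lra)). cbv beta in Hc.
  set (s1 := Csum _ M) in *. set (s2 := Csum (fun n => f n z) M) in *.
  set (t1 := CSeries _) in *. set (t2 := CSeries (fun n => f (M + n)%nat z)) in *.
  replace (s1 + t1 - (s2 + t2)) with ((s1 - s2) + (t1 + - t2)) by ring.
  eapply Rle_lt_trans; [apply Cmod_triangle|].
  pose proof (Cmod_triangle t1 (- t2)) as T. rewrite Cmod_opp in T. lra.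
Qed.

Lemma ex_series_qdecay (a : nat -> R) (c g : R) : (0 < c)%R -> (0 < g < 1)%R ->
  (0 < a O)%R -> (forall n, a (S n) = (c * g ^ n * a n)%R) -> ex_series a.
Proof.
  intros Hc Hg H0 HS.
  assert (Hp : forall n, (0 < a n)%R).
  { induction n; [assumption|]. rewrite HS. repeat apply Rmult_lt_0_compat; try lra.
    apply pow_lt; lra. }
  apply ex_series_Rabs, ex_series_DAlembert with 0%R; [lra| |].
  - intros n. specialize (Hp n). lra.
  - apply is_lim_seq_ext with (fun n => (c * g ^ n)%R).
    + intros n. rewrite HS. specialize (Hp n).
      replace (c * g ^ n * a n / a n)%R with (c * g ^ n)%R by (field; lra).
      rewrite Rabs_right; [reflexivity|]. apply Rle_ge, Rmult_le_pos; [lra|apply pow_le; lra].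
    + replace (Finite 0) with (Rbar_mult c 0) by (simpl; now rewrite Rmult_0_r).
      apply is_lim_seq_scal_l, is_lim_seq_geom. rewrite Rabs_right; lra.
Qed.

(** * Theta: convergence, continuity, functional equation, nonvanishing *)

Definition theta_pos (q : C) (m : nat) (z : C) : C :=
  Cpw (-1) m * Cinv (Cpw q (m * (m - 1) / 2)) * Cpw z m.

Definition theta_neg (q : C) (m : nat) (z : C) : C :=
  Cpw (-1) (S m) * Cinv (Cpw q ((S m) * (S (S m)) / 2) * Cpw z (S m)).

Lemma theta_split (q z : C) :
  theta q z = - (CSeries (fun m => theta_pos q m z) + CSeries (fun m => theta_neg q m z)).
Proof. reflexivity. Qed.

Lemma Cinv_mult_distr (a b : C) : a <> 0 -> b <> 0 -> / (a * b) = / a * / b.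
Proof. intros. field. now split. Qed.

Lemma RtoC_m1 : RtoC (-1) = - RtoC 1.
Proof. now rewrite <- RtoC_opp. Qed.

Lemma triangular_S m : (S m * (S m - 1) / 2 = m * (m - 1) / 2 + m)%nat.
Proof.
  replace (S m * (S m - 1))%nat with (m * (m - 1) + m * 2)%nat by (destruct m; simpl; lia).
  now rewrite Nat.div_add by lia.
Qed.

Lemma theta_pos_0 (q z : C) : theta_pos q 0 z = 1.
Proof. unfold theta_pos. to_Cpow. simpl. field. Qed.

Lemma theta_pos_S (q : C) (m : nat) (z : C) : q <> 0 ->
  theta_pos q (S m) z = - z / q ^ m * theta_pos q m z.
Proof.
  intros Hq. unfold theta_pos. rewrite triangular_S. to_Cpow. rewrite Cpow_add_r, !Cpow_S.
  rewrite Cinv_mult_distr by now apply Cpow_nz.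
  unfold Cdiv. to_Cpow. rewrite RtoC_m1. ring.
Qed.

Lemma theta_neg_0 (q z : C) : q <> 0 -> z <> 0 -> theta_neg q 0 z = - / (q * z).
Proof.
  intros Hq Hz. unfold theta_neg. to_Cpow. change (1 * 2 / 2)%nat with 1%nat. rewrite !Cpow_1_r, RtoC_m1.
  field. now split.
Qed.

Lemma theta_neg_S (q : C) (m : nat) (z : C) : q <> 0 -> z <> 0 ->
  theta_neg q (S m) z = - / (q ^ (m + 2) * z) * theta_neg q m z.
Proof.
  intros Hq Hz. unfold theta_neg.
  replace (S (S m) * S (S (S m)) / 2)%nat with (S m * S (S m) / 2 + (m + 2))%nat.
  2:{ replace (S (S m) * S (S (S m)))%nat with (S m * S (S m) + (m + 2) * 2)%nat by lia.
      now rewrite Nat.div_add by lia. }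
  to_Cpow. rewrite Cpow_add_r, (Cpow_S z (S m)), (Cpow_S (-1) (S m)), RtoC_m1.
  rewrite !Cinv_mult_distr; try (now apply Cpow_nz); try assumption.
  - ring.
  - apply Cmult_neq_0; now apply Cpow_nz.
  - apply Cmult_neq_0; [assumption|now apply Cpow_nz].
Qed.

Lemma Cmod_gt_1_neq_0 (q : C) : (1 < Cmod q)%R -> q <> 0.
Proof. intros H. apply Cmod_gt_0. lra. Qed.

Lemma theta_pos_summable (q z : C) : (1 < Cmod q)%R -> z <> 0 ->
  Csummable (fun m => theta_pos q m z).
Proof.
  intros Hq Hz. pose proof (Cmod_gt_1_neq_0 q Hq) as Hq0.
  apply ex_series_qdecay with (Cmod z) (/ Cmod q)%R.
  - now apply Cmod_gt_0.
  - split; [apply Rinv_0_lt_compat; lra|]. rewrite <- Rinv_1. apply Rinv_lt_contravar; lra.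
  - rewrite theta_pos_0, Cmod_1. lra.
  - intros n. rewrite theta_pos_S by assumption.
    rewrite Cmod_mult, Cmod_div, Cmod_opp, Cmod_pow, pow_inv by now apply Cpow_nz.
    reflexivity.
Qed.

Lemma theta_neg_summable (q z : C) : (1 < Cmod q)%R -> z <> 0 ->
  Csummable (fun m => theta_neg q m z).
Proof.
  intros Hq Hz. pose proof (Cmod_gt_1_neq_0 q Hq) as Hq0.
  pose proof (proj1 (Cmod_gt_0 z) Hz) as Hz0.
  apply ex_series_qdecay with (/ (Cmod q ^ 2 * Cmod z))%R (/ Cmod q)%R.
  - apply Rinv_0_lt_compat, Rmult_lt_0_compat; [apply pow_lt; lra|assumption].
  - split; [apply Rinv_0_lt_compat; lra|]. rewrite <- Rinv_1. apply Rinv_lt_contravar; lra.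
  - rewrite theta_neg_0, Cmod_opp by assumption. rewrite Cmod_inv by now apply Cmult_neq_0.
    now apply Rinv_0_lt_compat, Cmod_gt_0, Cmult_neq_0.
  - intros n. rewrite theta_neg_S by assumption.
    rewrite Cmod_mult, Cmod_opp, Cmod_inv, Cmod_mult, Cmod_pow, pow_inv
      by (apply Cmult_neq_0; [now apply Cpow_nz|assumption]).
    f_equal. rewrite pow_add. field.
    repeat split; try apply pow_nonzero; lra.
Qed.

Lemma theta_pos_bound (q : C) (m : nat) (z w : C) : (Cmod z <= Cmod w)%R -> q <> 0 ->
  (Cmod (theta_pos q m z) <= Cmod (theta_pos q m w))%R.
Proof.
  intros H Hq. unfold theta_pos. rewrite !Cmod_mult. apply Rmult_le_compat_l.
  - apply Rmult_le_pos; apply Cmod_ge_0.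
  - to_Cpow. rewrite !Cmod_pow. apply pow_incr. split; [apply Cmod_ge_0|assumption].
Qed.

Lemma theta_neg_bound (q : C) (m : nat) (z w : C) : (Cmod w <= Cmod z)%R -> q <> 0 -> w <> 0 ->
  (Cmod (theta_neg q m z) <= Cmod (theta_neg q m w))%R.
Proof.
  intros H Hq Hw. pose proof (proj1 (Cmod_gt_0 w) Hw).
  assert (Hz : z <> 0) by (apply Cmod_gt_0; lra).
  unfold theta_neg. rewrite !Cmod_mult. apply Rmult_le_compat_l; [apply Cmod_ge_0|].
  to_Cpow.
  rewrite !Cmod_inv by (apply Cmult_neq_0; now apply Cpow_nz).
  rewrite !Cmod_mult, !Cmod_pow. apply Rinv_le_contravar.
  - apply Rmult_lt_0_compat; apply pow_lt; [now apply Cmod_gt_0|assumption].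
  - apply Rmult_le_compat_l; [apply pow_le, Cmod_ge_0|].
    apply pow_incr. lra.
Qed.

Lemma Ccont_inv (z : C) : z <> 0 -> Ccont Cinv z.
Proof.
  intros Hz eps He. pose proof (proj1 (Cmod_gt_0 z) Hz) as P. set (m := Cmod z) in *.
  assert (Q : (0 < eps * m * m / 2)%R).
  { repeat apply Rmult_lt_0_compat; lra. }
  exists (Rmin (m / 2) (eps * m * m / 2)). split; [apply Rmin_pos; lra|]. intros w Hw.
  pose proof (Rmin_l (m / 2) (eps * m * m / 2)). pose proof (Rmin_r (m / 2) (eps * m * m / 2)).
  pose proof (Cmod_triangle_sub z w 0) as T.
  replace (z - 0) with z in T by ring. replace (w - 0) with w in T by ring.
  rewrite (Cmod_sub_sym z w) in T. fold m in T.
  assert (W : (m / 2 < Cmod w)%R) by lra.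
  assert (Hw0 : w <> 0) by (apply Cmod_gt_0; lra).
  replace (/ w - / z) with (- (w - z) / (w * z)) by (field; now split).
  rewrite Cmod_div, Cmod_opp, Cmod_mult by now apply Cmult_neq_0. fold m.
  apply (Rmult_lt_reg_r (Cmod w * m)); [nra|].
  replace (Cmod (w - z) / (Cmod w * m) * (Cmod w * m))%R with (Cmod (w - z)) by (field; lra).
  assert (eps * m * (m / 2) < eps * m * Cmod w)%R; [|nra].
  apply Rmult_lt_compat_l; nra.
Qed.

Lemma Ccont_pow n z : Ccont (fun w => w ^ n) z.
Proof.
  pose proof (Ccont_pow_sub 0 n z) as H. intros eps He.
  destruct (H eps He) as [d [Hd K]]. exists d. split; [assumption|]. intros w Hw.
  specialize (K w Hw). cbv beta in K.
  replace (w - 0) with w in K by ring. now replace (z - 0) with z in K by ring.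
Qed.

Lemma theta_pos_cont (q : C) (m : nat) (z : C) : Ccont (theta_pos q m) z.
Proof.
  unfold theta_pos. apply Ccont_mult; [apply Ccont_const|].
  intros eps He. destruct (Ccont_pow m z eps He) as [d [Hd K]]. exists d.
  split; [assumption|]. intros w Hw. to_Cpow. now apply K.
Qed.

Lemma theta_neg_cont (q : C) (m : nat) (z : C) : q <> 0 -> z <> 0 -> Ccont (theta_neg q m) z.
Proof.
  intros Hq Hz. unfold theta_neg. apply Ccont_mult; [apply Ccont_const|].
  apply (Ccont_comp Cinv (fun w => Cpw q (S m * S (S m) / 2) * Cpw w (S m))).
  - apply Ccont_mult; [apply Ccont_const|].
    intros eps He. destruct (Ccont_pow (S m) z eps He) as [d [Hd K]]. exists d.
    split; [assumption|]. intros w Hw. to_Cpow. now apply K.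
  - apply Ccont_inv. to_Cpow. apply Cmult_neq_0; now apply Cpow_nz.
Qed.

(** On the annulus |z| / 2 <= |w| <= 2 |z| the nonnegative powers are dominated by their values at 2
    z and the negative ones by their values at z / 2, which gives a summable majorant. *)
Lemma theta_cont (q z : C) : (1 < Cmod q)%R -> z <> 0 -> Ccont (theta q) z.
Proof.
  intros Hq Hz. pose proof (Cmod_gt_1_neq_0 q Hq) as Hq0.
  pose proof (proj1 (Cmod_gt_0 z) Hz) as P.
  assert (N2 : RtoC 2 * z <> 0).
  { apply Cmult_neq_0; [|assumption]. intros K. apply RtoC_inj in K. lra. }
  assert (Nh : RtoC (1 / 2) * z <> 0).
  { apply Cmult_neq_0; [|assumption]. intros K. apply RtoC_inj in K. lra. }
  assert (M2 : Cmod (RtoC 2 * z) = (2 * Cmod z)%R).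
  { rewrite Cmod_mult, Cmod_R, Rabs_right; lra. }
  assert (Mh : Cmod (RtoC (1 / 2) * z) = (1 / 2 * Cmod z)%R).
  { rewrite Cmod_mult, Cmod_R, Rabs_right; lra. }
  assert (B : forall w, (Cmod (w - z) < Cmod z / 2)%R ->
     (Cmod z / 2 <= Cmod w <= 2 * Cmod z)%R).
  { intros w Hw. pose proof (Cmod_triangle_sub z w 0) as T.
    pose proof (Cmod_triangle_sub w z 0) as T'.
    replace (z - 0) with z in * by ring. replace (w - 0) with w in * by ring.
    rewrite (Cmod_sub_sym z w) in T. lra. }
  assert (K : Ccont (fun w => - (1) * (CSeries (fun m => theta_pos q m w)
                                 + CSeries (fun m => theta_neg q m w))) z).
  { apply Ccont_mult; [apply Ccont_const|]. apply Ccont_plus.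
    - apply Ccont_CSeries with (A := fun m => Cmod (theta_pos q m (RtoC 2 * z)))
        (r := (Cmod z / 2)%R); [lra|now apply theta_pos_summable| |].
      + intros n. apply theta_pos_cont.
      + intros w n Hw. apply theta_pos_bound; [|assumption]. rewrite M2. now apply B.
    - apply Ccont_CSeries with (A := fun m => Cmod (theta_neg q m (RtoC (1 / 2) * z)))
        (r := (Cmod z / 2)%R); [lra|now apply theta_neg_summable| |].
      + intros n. now apply theta_neg_cont.
      + intros w n Hw. apply theta_neg_bound; [|assumption..]. rewrite Mh.
        specialize (B w Hw). lra. }
  intros eps He. destruct (K eps He) as [d [Hd H]]. exists d. split; [assumption|].
  intros w Hw. specialize (H w Hw). rewrite !theta_split.
  match type of H with (Cmod ?a < _)%R => match goal with |- (Cmod ?b < _)%R =>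
    replace b with a by ring; exact H end end.
Qed.

(** Replacing z by q z shifts the Laurent series by one index, up to the factor -q z. At the seam,
    the constant term 1 at q z is -q z times the first negative term -1 / (q z) at z. *)
Lemma theta_shift (q z : C) : (1 < Cmod q)%R -> z <> 0 ->
  theta q (q * z) = - (q * z) * theta q z.
Proof.
  intros Hq Hz. pose proof (Cmod_gt_1_neq_0 q Hq) as Hq0.
  assert (Hqz : q * z <> 0) by now apply Cmult_neq_0.
  pose proof (theta_pos_summable q z Hq Hz) as S1.
  pose proof (theta_neg_summable q z Hq Hz) as S2.
  pose proof (theta_pos_summable q (q * z) Hq Hqz) as S3.
  assert (EP : forall m, theta_pos q (S m) (q * z) = - (q * z) * theta_pos q m z).
  { induction m.
    - rewrite theta_pos_S, !theta_pos_0 by assumption. simpl. field.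
    - rewrite theta_pos_S, IHm, (theta_pos_S q m z) by assumption.
      rewrite Cpow_S. field. split; [|assumption]. now apply Cpow_nz. }
  assert (EN : forall m, theta_neg q m (q * z) = - (q * z) * theta_neg q (S m) z).
  { induction m.
    - rewrite (theta_neg_S q 0 z), !theta_neg_0 by assumption. simpl. field. now split.
    - rewrite theta_neg_S, IHm, (theta_neg_S q (S m) z) by assumption.
      simpl Nat.add. rewrite !Cpow_S, Cpow_add_r. field.
      repeat split; try assumption; try now apply Cpow_nz. }
  rewrite !theta_split.
  rewrite (CSeries_incr_1 _ S3), theta_pos_0.
  rewrite (CSeries_ext (fun n => theta_pos q (S n) (q * z)) _ EP).
  rewrite (CSeries_ext (fun n => theta_neg q n (q * z)) _ EN).
  rewrite CSeries_scal by assumption.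
  rewrite (CSeries_scal _ (fun n => theta_neg q (S n) z)) by exact (Csummable_S _ S2).
  rewrite (CSeries_incr_1 _ S2), theta_neg_0 by assumption.
  field. now split.
Qed.

Lemma geometric_root_of_unity (v : C) N : v ^ N = 1 -> v <> 1 -> Csum (fun j => v ^ j) N = 0.
Proof.
  intros HN Hv.
  assert (E : forall n, (v - 1) * Csum (fun j => v ^ j) n = v ^ n - 1).
  { induction n; [simpl; ring|]. simpl Csum. rewrite Cpow_S.
    transitivity ((v - 1) * Csum (fun j => v ^ j) n + (v - 1) * v ^ n); [ring|].
    rewrite IHn. ring. }
  specialize (E N). rewrite HN in E. replace (RtoC 1 - 1) with (RtoC 0) in E by ring.
  apply Cmult_integral in E. destruct E as [E|E]; [|assumption].
  exfalso. apply Hv. rewrite <- (Cplus_0_l 1), <- E. ring.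
Qed.

Lemma primitive_root_exists N : (0 < N)%nat -> exists u : C,
  Cmod u = 1%R /\ u ^ N = 1 /\ forall m, (0 < m < N)%nat -> u ^ m <> 1.
Proof.
  intros HN. set (x := (2 * PI / INR N)%R). exists (cos x, sin x).
  assert (HN' : (0 < INR N)%R) by now apply lt_0_INR.
  assert (E : forall m, (cos x, sin x) ^ m = (cos (INR m * x), sin (INR m * x))%R).
  { induction m.
    - simpl. rewrite Rmult_0_l, cos_0, sin_0. reflexivity.
    - rewrite Cpow_S, IHm, S_INR, Rmult_plus_distr_r, Rmult_1_l.
      rewrite cos_plus, sin_plus. unfold Cmult; simpl. f_equal; ring. }
  repeat split.
  - unfold Cmod; simpl fst; simpl snd.
    replace (cos x ^ 2 + sin x ^ 2)%R with (Rsqr (sin x) + Rsqr (cos x))%R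
      by (unfold Rsqr; ring).
    rewrite sin2_cos2. apply sqrt_1.
  - rewrite E. replace (INR N * x)%R with (2 * PI)%R by (unfold x; field; lra).
    rewrite cos_2PI, sin_2PI. reflexivity.
  (* By the double angle formula cos (m x) = 1 would force sin (m pi / N) = 0, but m pi / N lies
     strictly between 0 and pi. *)
  - intros m Hm K. rewrite E in K. apply (f_equal fst) in K. simpl in K.
    replace (INR m * x)%R with (2 * (INR m * PI / INR N))%R in K by (unfold x; field; lra).
    rewrite cos_2a_sin in K.
    assert (P : (0 < sin (INR m * PI / INR N))%R); [|nra].
    assert (Hm1 : (0 < INR m)%R) by (apply lt_0_INR; lia).
    assert (Hm2 : (INR m < INR N)%R) by (apply lt_INR; lia).
    pose proof PI_RGT_0.
    apply sin_gt_0.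
    + apply Rdiv_lt_0_compat; nra.
    + apply (Rmult_lt_reg_r (INR N)); [assumption|].
      replace (INR m * PI / INR N * INR N)%R with (INR m * PI)%R by (field; lra). nra.
Qed.

(* Averaging over the N-th roots of unity isolates the constant term of a
   truncation of the Laurent series; the remaining tail is small on |z| = 1. *)
Lemma theta_nonzero (q : C) : (1 < Cmod q)%R -> exists z : C, z <> 0 /\ theta q z <> 0.
Proof.
  intros Hq. pose proof (Cmod_gt_1_neq_0 q Hq) as Hq0.
  apply NNPP. intros N0.
  assert (Z : forall z : C, z <> 0 -> theta q z = 0).
  { intros z Hz. apply NNPP. intros K. apply N0. now exists z. }
  assert (one0 : RtoC 1 <> 0) by (intros K; apply RtoC_inj in K; lra).
  pose proof (theta_pos_summable q 1 Hq one0) as S1.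
  pose proof (theta_neg_summable q 1 Hq one0) as S2.
  (* Each complex tail is then at most 2 / 8, so on |z| = 1 the truncation stays below 1 in
     modulus. *)
  destruct (Series_tail_small _ (1 / 8) S1 ltac:(lra)) as [M1 HM1].
  destruct (Series_tail_small _ (1 / 8) S2 ltac:(lra)) as [M2 HM2].
  (* The successor makes [M] positive, so the truncation contains the constant term. *)
  set (M := S (Nat.max M1 M2)).
  specialize (HM1 M ltac:(lia)). specialize (HM2 M ltac:(lia)). cbv beta in HM1, HM2.
  set (F := fun z => Csum (fun m => theta_pos q m z) M + Csum (fun m => theta_neg q m z) M).
  assert (HF : forall z, Cmod z = 1%R -> (Cmod (F z) < 1)%R).
  { intros z Hz. assert (Hz0 : z <> 0) by (apply Cmod_gt_0; lra).
    pose proof (Z z Hz0) as E. rewrite theta_split in E.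
    rewrite (CSeries_shift (fun m => theta_pos q m z) M) in E by now apply theta_pos_summable.
    rewrite (CSeries_shift (fun m => theta_neg q m z) M) in E by now apply theta_neg_summable.
    assert (B1 : (Cmod (CSeries (fun n => theta_pos q (M + n) z)) <= 2 * (1 / 8))%R).
    { eapply Rle_trans; [apply (CSeries_bound _ (fun n => Cmod (theta_pos q (M + n) 1)))|].
      - intros n. apply theta_pos_bound; [rewrite Cmod_1; lra|assumption].
      - apply (ex_series_incr_n (fun n => Cmod (theta_pos q n 1)) M). exact S1.
      - lra. }
    assert (B2 : (Cmod (CSeries (fun n => theta_neg q (M + n) z)) <= 2 * (1 / 8))%R).
    { eapply Rle_trans; [apply (CSeries_bound _ (fun n => Cmod (theta_neg q (M + n) 1)))|].
      - intros n. apply theta_neg_bound; [rewrite Cmod_1; lra|assumption..].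
      - apply (ex_series_incr_n (fun n => Cmod (theta_neg q n 1)) M). exact S2.
      - lra. }
    unfold F. set (s1 := Csum (fun m => theta_pos q m z) M) in *.
    set (s2 := Csum (fun m => theta_neg q m z) M) in *.
    set (t1 := CSeries (fun n => theta_pos q (M + n) z)) in *. set (t2 := CSeries (fun n => theta_neg q (M + n) z)) in *.
    replace (s1 + s2) with (- (t1 + t2)).
    - rewrite Cmod_opp. eapply Rle_lt_trans; [apply Cmod_triangle|]. lra.
    - transitivity (- (s1 + t1 + (s2 + t2)) + (s1 + s2)); [ring|]. rewrite E. ring. }
  (* The exponents in the truncation run from -M to M - 1, and 0 is the only multiple of M + 1 among
     them. *)
  destruct (primitive_root_exists (S M) ltac:(lia)) as (u & U1 & U2 & U3).
  assert (U0 : u <> 0) by (apply Cmod_gt_0; lra).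
  assert (Upow : forall j m : nat, (u ^ j) ^ m = (u ^ m) ^ j).
  { intros j m. rewrite <- !Cpow_mult_r. f_equal. lia. }
  assert (EP : forall m, (m < M)%nat ->
     Csum (fun j => theta_pos q m (u ^ j)) (S M) =
     match m with O => RtoC (INR (S M)) | S _ => RtoC 0 end).
  { intros m Hm. destruct m as [|m].
    - rewrite (Csum_ext _ (fun _ => RtoC 1)) by (intros; apply theta_pos_0).
      rewrite Csum_const. ring.
    - unfold theta_pos.
      rewrite (Csum_ext _ (fun j => Cpw (-1) (S m) * / Cpw q (S m * (S m - 1) / 2) * (u ^ S m) ^ j))
        by (intros; now rewrite (Cpw_pow (u ^ _)), Upow).
      rewrite Csum_scal, geometric_root_of_unity; [ring| |].
      + rewrite Upow, U2. apply Cpow_1_l.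
      + apply U3. lia. }
  assert (EN : forall m, (m < M)%nat -> Csum (fun j => theta_neg q m (u ^ j)) (S M) = 0).
  { intros m Hm. unfold theta_neg.
    rewrite (Csum_ext _ (fun j => Cpw (-1) (S m) * / Cpw q (S m * S (S m) / 2) * (/ u ^ S m) ^ j)).
    - rewrite Csum_scal, geometric_root_of_unity; [ring| |].
      + rewrite Cpow_inv by now apply Cpow_nz. rewrite Upow, U2, Cpow_1_l. field.
      + intros K. apply (U3 (S m) ltac:(lia)).
        transitivity (u ^ S m * / u ^ S m); [rewrite K; ring|]. apply Cinv_r. now apply Cpow_nz.
    - intros j _. rewrite (Cpw_pow (u ^ j)), Upow, Cpow_inv by now apply Cpow_nz.
      rewrite Cinv_mult_distr; [ring|rewrite Cpw_pow; now apply Cpow_nz|].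
      apply Cpow_nz. now apply Cpow_nz. }
  assert (E : Csum (fun j => F (u ^ j)) (S M) = RtoC (INR (S M))).
  { unfold F. rewrite Csum_plus, (Csum_exchange (fun j m => theta_pos q m (u ^ j))),
      (Csum_exchange (fun j m => theta_neg q m (u ^ j))).
    rewrite (Csum_ext _ _ M EP), (Csum_ext _ _ M EN), Csum_0.
    unfold M. rewrite Csum_Sn_l, Csum_0. ring. }
  (* M + 1 values of modulus below 1 cannot add up to M + 1. *)
  pose proof (Csum_Cmod_lt (fun j => F (u ^ j)) (S M) 1 ltac:(lia)) as L.
  rewrite E, Cmod_R, Rabs_right in L by (apply Rle_ge, pos_INR).
  rewrite Rmult_1_r in L. apply (Rlt_irrefl (INR (S M))), L.
  intros k _. apply HF. rewrite Cmod_pow, U1. apply pow1.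
Qed.

(** * Generic points: countable unions of discrete exceptional sets *)

(** A sequence of exceptional sets is allowed because an identity along the whole orbit contributes
    one dilated set for every N. *)
Definition generic (P : C -> Prop) : Prop :=
  exists S : nat -> C -> Prop, (forall n, discrete_in_Cstar (S n)) /\
    forall z : C, z <> 0 -> (forall n, ~ S n z) -> P z.

Lemma discrete_empty : discrete_in_Cstar (fun _ => False).
Proof. split; [tauto|]. intros z _. exists 1%R. split; [lra|]. tauto. Qed.

Lemma discrete_union S T : discrete_in_Cstar S -> discrete_in_Cstar T ->
  discrete_in_Cstar (fun z => S z \/ T z).
Proof.
  intros [S0 HS] [T0 HT]. split.
  - intros z [H|H]; auto.
  - intros z Hz. destruct (HS z Hz) as [r [Hr H]]. destruct (HT z Hz) as [r' [Hr' H']].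
    exists (Rmin r r'). split; [now apply Rmin_pos|]. intros w W1 W2.
    pose proof (Rmin_l r r'). pose proof (Rmin_r r r').
    intros [K|K]; [apply (H w); auto; lra|apply (H' w); auto; lra].
Qed.

Lemma discrete_dilate S (c : C) : c <> 0 -> discrete_in_Cstar S ->
  discrete_in_Cstar (fun z => S (c * z)).
Proof.
  intros Hc [S0 HS]. pose proof (proj1 (Cmod_gt_0 c) Hc) as P. split.
  - intros z H ->. apply (S0 _ H). ring.
  - intros z Hz. destruct (HS (c * z)) as [r [Hr H]]; [now apply Cmult_neq_0|].
    exists (r / Cmod c)%R. split; [now apply Rdiv_lt_0_compat|]. intros w W1 W2.
    assert (E : Cmod (c * w - c * z) = (Cmod c * Cmod (w - z))%R)
      by (rewrite <- Cmod_mult; f_equal; ring).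
    apply H; rewrite E.
    + now apply Rmult_lt_0_compat.
    + apply (Rmult_lt_compat_l (Cmod c)) in W2; [|assumption].
      replace (Cmod c * (r / Cmod c))%R with r in W2 by (field; lra). assumption.
Qed.

Lemma generic_impl (P Q : C -> Prop) : (forall z : C, z <> 0 -> P z -> Q z) ->
  generic P -> generic Q.
Proof. intros H [S [HS HP]]. exists S. split; auto. Qed.

Lemma generic_all (P : C -> Prop) : (forall z : C, z <> 0 -> P z) -> generic P.
Proof. intros H. exists (fun _ _ => False). split; [intros; apply discrete_empty|auto]. Qed.

Lemma generic_and (P Q : C -> Prop) :
  generic P -> generic Q -> generic (fun z => P z /\ Q z).
Proof.
  intros [S [HS HP]] [T [HT HQ]]. exists (fun n z => S n z \/ T n z). split.
  - intros n. now apply discrete_union.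
  - intros z Hz H. split; [apply HP|apply HQ]; auto; intros n K; apply (H n); tauto.
Qed.

Lemma generic_forall_lt (P : nat -> C -> Prop) n :
  (forall i, (i < n)%nat -> generic (P i)) ->
  generic (fun z => forall i, (i < n)%nat -> P i z).
Proof.
  induction n; intros H.
  - apply generic_all. intros; lia.
  - apply generic_impl with (fun z => (forall i, (i < n)%nat -> P i z) /\ P n z).
    + intros z _ [H1 H2] i Hi. destruct (Nat.eq_dec i n) as [->|]; [assumption|].
      apply H1. lia.
    + apply generic_and; auto.
Qed.

Lemma generic_forall_In {A} (P : A -> C -> Prop) (l : list A) :
  (forall a, In a l -> generic (P a)) -> generic (fun z => forall a, In a l -> P a z).
Proof.
  induction l as [|b l IH]; intros H.
  - apply generic_all. intros z _ a [].
  - apply generic_impl with (fun z => P b z /\ (forall a, In a l -> P a z)).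
    + intros z _ [H1 H2] a [<-|Ha]; auto.
    + apply generic_and; [apply H; now left|apply IH; intros; apply H; now right].
Qed.

Lemma mer_eq_generic_orbit f g (q : C) : q <> 0 -> mer_eq f g ->
  generic (fun z => forall N, f (q ^ N * z) = g (q ^ N * z)).
Proof.
  intros Hq [S [HS H]]. exists (fun N z => S (q ^ N * z)). split.
  - intros N. apply discrete_dilate; [now apply Cpow_nz|assumption].
  - intros z Hz K N. apply H; [|apply K]. apply Cmult_neq_0; [now apply Cpow_nz|assumption].
Qed.

Lemma avoid_discrete S (a : C) (lo hi : R) : discrete_in_Cstar S -> (lo < hi)%R ->
  (forall t : R, (lo <= t <= hi)%R -> a + RtoC t <> 0) ->
  exists lo' hi' : R, (lo <= lo')%R /\ (lo' < hi')%R /\ (hi' <= hi)%R /\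
    forall t : R, (lo' <= t <= hi')%R -> ~ S (a + RtoC t).
Proof.
  intros [_ HS] Hlh Hn. set (m := ((lo + hi) / 2)%R).
  destruct (HS (a + RtoC m)) as [r [Hr H]]; [apply Hn; unfold m; lra|].
  set (e := Rmin r (hi - m)).
  assert (E0 : (0 < e)%R) by (apply Rmin_pos; unfold m in *; lra).
  assert (E1 : (e <= r)%R) by apply Rmin_l.
  assert (E2 : (e <= hi - m)%R) by apply Rmin_r.
  (* The interval stays close to the midpoint but off it, since [S] may contain the midpoint
     itself. *)
  exists (m + e / 3)%R, (m + 2 * e / 3)%R. repeat split; try (unfold m in *; lra).
  intros t Ht. apply H.
  - replace (a + RtoC t - (a + RtoC m)) with (RtoC (t - m)) by (rewrite RtoC_minus; ring).
    rewrite Cmod_R, Rabs_right; lra.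
  - replace (a + RtoC t - (a + RtoC m)) with (RtoC (t - m)) by (rewrite RtoC_minus; ring).
    rewrite Cmod_R, Rabs_right; lra.
Qed.

(* Baire's argument, along a real segment inside the ball. *)
Lemma generic_dense P (z : C) (r : R) : generic P -> (0 < r)%R ->
  exists w : C, (Cmod (w - z) < r)%R /\ w <> 0 /\ P w.
Proof.
  intros [S [HS HP]] Hr.
  destruct (nonzero_subball z r Hr) as (a & s & Hs & Ha & Hsub).
  pose proof (proj1 (Cmod_gt_0 a) Ha) as Pa.
  (* The segment a + [0, h] stays inside the ball and cannot reach 0. *)
  set (h := (Rmin s (Cmod a) / 2)%R).
  assert (H0 : (0 < Rmin s (Cmod a))%R) by now apply Rmin_pos.
  pose proof (Rmin_l s (Cmod a)). pose proof (Rmin_r s (Cmod a)).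
  assert (Hn : forall t : R, (0 <= t <= h)%R -> a + RtoC t <> 0).
  { intros t Ht K. assert (E : a = - RtoC t) by (rewrite <- (Cplus_0_l (- RtoC t)), <- K; ring).
    rewrite E, Cmod_opp, Cmod_R, Rabs_right in Pa by lra.
    rewrite E, Cmod_opp, Cmod_R, Rabs_right in H1 by lra.
    unfold h in Ht. rewrite E, Cmod_opp, Cmod_R, Rabs_right in Ht by lra. lra. }
  set (good := fun p : R * R => (0 <= fst p)%R /\ (fst p < snd p)%R /\ (snd p <= h)%R).
  assert (step : forall n p, exists p', good p -> good p' /\ (fst p <= fst p')%R /\
    (snd p' <= snd p)%R /\ forall t : R, (fst p' <= t <= snd p')%R -> ~ S n (a + RtoC t)).
  { intros n [lo hi]. destruct (classic (good (lo, hi))) as [G|G]; [|now exists (lo, hi)].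
    destruct G as (G1 & G2 & G3). simpl in *.
    destruct (avoid_discrete (S n) a lo hi (HS n) G2) as (lo' & hi' & A1 & A2 & A3 & A4).
    - intros t Ht. apply Hn. lra.
    - exists (lo', hi'). intros _. unfold good. simpl. repeat split; try lra. exact A4. }
  set (next := fun n p => proj1_sig (constructive_indefinite_description _ (step n p))).
  set (u := fix u n := match n with O => (0%R, h) | Datatypes.S m => next m (u m) end).
  assert (Hu : forall n, good (u n)).
  { induction n.
    - unfold good; simpl. unfold h; lra.
    - simpl. unfold next. destruct (constructive_indefinite_description _ (step n (u n))) as [p' Hp].
      simpl. apply Hp, IHn. }
  assert (Hnx : forall n, (fst (u n) <= fst (u (Datatypes.S n)))%R /\
    (snd (u (Datatypes.S n)) <= snd (u n))%R /\
    forall t : R, (fst (u (Datatypes.S n)) <= t <= snd (u (Datatypes.S n)))%R -> ~ S n (a + RtoC t)).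
  { intros n. simpl. unfold next.
    destruct (constructive_indefinite_description _ (step n (u n))) as [p' Hp].
    simpl. apply Hp, Hu. }
  destruct (nested_intervals (fun n => fst (u n)) (fun n => snd (u n))) as [x Hx].
  { apply Hnx. } { apply Hnx. } { intros n. destruct (Hu n) as (_ & L & _). lra. }
  assert (Hx0 : (0 <= x <= h)%R) by exact (Hx 0%nat).
  exists (a + RtoC x). split.
  - apply Hsub. replace (a + RtoC x - a) with (RtoC x) by ring.
    rewrite Cmod_R, Rabs_right; unfold h in *; lra.
  - assert (N : a + RtoC x <> 0) by now apply Hn. split; [assumption|].
    apply HP; [assumption|]. intros n. apply Hnx. exact (Hx (Datatypes.S n)).
Qed.

(** * Polynomials with constant coefficients; growth classes of sequences *)

Fixpoint ev (p : list C) (x : C) : C :=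
  match p with nil => 0 | a :: p' => a + x * ev p' x end.

Definition zero_list (p : list C) : Prop := forall a, In a p -> a = 0.

Fixpoint padd (p r : list C) : list C :=
  match p, r with
  | nil, _ => r
  | _, nil => p
  | a :: p', b :: r' => (a + b) :: padd p' r'
  end.

Definition pscal (c : C) (p : list C) : list C := map (fun a => c * a) p.

Fixpoint pmul (p r : list C) : list C :=
  match p with nil => nil | a :: p' => padd (pscal a r) (RtoC 0 :: pmul p' r) end.

Fixpoint pprod (d : nat -> list C) (n : nat) : list C :=
  match n with O => RtoC 1 :: nil | S m => pmul (pprod d m) (d m) end.

Fixpoint Cprod (f : nat -> C) (n : nat) : C :=
  match n with O => 1 | S m => Cprod f m * f m end.

Lemma ev_padd p r x : ev (padd p r) x = ev p x + ev r x.
Proof.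
  revert r. induction p as [|a p IH]; intros [|b r]; simpl; try ring.
  rewrite IH. ring.
Qed.

Lemma ev_pscal c p x : ev (pscal c p) x = c * ev p x.
Proof. induction p as [|a p IH]; simpl; [ring|]. fold (pscal c p). rewrite IH. ring. Qed.

Lemma ev_pmul p r x : ev (pmul p r) x = ev p x * ev r x.
Proof.
  induction p as [|a p IH]; simpl; [ring|].
  rewrite ev_padd, ev_pscal. simpl. rewrite IH. ring.
Qed.

Lemma ev_pprod d n x : ev (pprod d n) x = Cprod (fun j => ev (d j) x) n.
Proof. induction n; simpl; [ring|]. now rewrite ev_pmul, IHn. Qed.

Lemma ev_zero_list p x : zero_list p -> ev p x = 0.
Proof.
  induction p as [|a p IH]; intros H; [reflexivity|]. simpl.
  rewrite (H a) by now left. rewrite IH; [ring|]. intros b Hb. apply H. now right.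
Qed.

Lemma Cprod_ext f g n : (forall j, (j < n)%nat -> f j = g j) -> Cprod f n = Cprod g n.
Proof. intros H. induction n; [reflexivity|]. simpl. rewrite IHn, H; auto. Qed.

Lemma Cprod_split f n i : (i < n)%nat ->
  Cprod f n = f i * Cprod (fun j => if Nat.eqb j i then 1 else f j) n.
Proof.
  induction n; intros Hi; [lia|]. simpl. destruct (Nat.eq_dec i n) as [->|N].
  - rewrite Nat.eqb_refl.
    rewrite (Cprod_ext (fun j => if Nat.eqb j n then 1 else f j) f).
    + ring.
    + intros j Hj. destruct (Nat.eqb_spec j n); [lia|reflexivity].
  - rewrite IHn by lia. destruct (Nat.eqb_spec n i); [lia|ring].
Qed.

Lemma Cprod_neq_0 (f : nat -> C) n : (forall j, (j < n)%nat -> f j <> 0) -> Cprod f n <> 0.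
Proof.
  induction n; intros H; simpl.
  - intros K. apply RtoC_inj in K. lra.
  - apply Cmult_neq_0; [apply IHn; intros; apply H|apply H]; lia.
Qed.

(** Induction on the Horner form: if the tail is at least c in modulus, then |a + x p(x)| >= c |x| -
    |a| >= c as soon as |x| >= 1 + |a| / c. *)
Lemma ev_lower_bound p : ~ zero_list p -> exists c R0 : R, (0 < c)%R /\
  forall x, (R0 <= Cmod x)%R -> (c <= Cmod (ev p x))%R.
Proof.
  induction p as [|a p IH]; intros H.
  - exfalso. apply H. intros b [].
  - destruct (classic (zero_list p)) as [Z|Z].
    + assert (Ha : a <> 0).
      { intros ->. apply H. intros b [<-|Hb]; [reflexivity|now apply Z]. }
      exists (Cmod a), 0%R. split; [now apply Cmod_gt_0|]. intros x _. simpl.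
      rewrite (ev_zero_list p x Z). right. f_equal. ring.
    + destruct (IH Z) as (c & R0 & Hc & HR). pose proof (Cmod_ge_0 a).
      exists c, (Rmax R0 (1 + Cmod a / c)). split; [assumption|]. intros x Hx.
      pose proof (Rmax_l R0 (1 + Cmod a / c)). pose proof (Rmax_r R0 (1 + Cmod a / c)).
      specialize (HR x ltac:(lra)). simpl.
      pose proof (Cmod_triangle (a + x * ev p x) (- a)) as T.
      replace (a + x * ev p x + - a) with (x * ev p x) in T by ring.
      rewrite Cmod_opp, Cmod_mult in T.
      assert (((1 + Cmod a / c) * c <= Cmod x * Cmod (ev p x))%R).
      { assert (0 <= Cmod a / c)%R by (apply Rdiv_le_0_compat; lra).
        apply Rmult_le_compat; lra. }
      replace ((1 + Cmod a / c) * c)%R with (c + Cmod a)%R in H3 by (field; lra). lra.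
Qed.

(* Eventually at most exponential growth. *)
Definition EG (s : nat -> C) : Prop := exists (rho B : R) (N0 : nat), (0 < rho)%R /\ (0 <= B)%R /\
  forall N, (N0 <= N)%nat -> (Cmod (s N) <= B * rho ^ N)%R.

(* Faster than exponential decay. *)
Definition SE (s : nat -> C) : Prop := forall rho : R, (0 < rho)%R ->
  exists (B : R) (N0 : nat), (0 <= B)%R /\
  forall N, (N0 <= N)%nat -> (rho ^ N * Cmod (s N) <= B)%R.

Definition eventually_eq (s u : nat -> C) : Prop :=
  exists N0, forall N, (N0 <= N)%nat -> s N = u N.

Lemma SE_ext s u : eventually_eq s u -> SE s -> SE u.
Proof.
  intros [N1 E] H rho Hr. destruct (H rho Hr) as (B & N0 & HB & K).
  exists B, (Nat.max N0 N1). split; [assumption|]. intros N HN.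
  rewrite <- E by lia. apply K. lia.
Qed.

Lemma SE_EG s : SE s -> EG s.
Proof.
  intros H. destruct (H 1%R ltac:(lra)) as (B & N0 & HB & K).
  exists 1%R, B, N0. repeat split; try lra. intros N HN. specialize (K N HN).
  rewrite pow1 in *. lra.
Qed.

Lemma SE_plus s u : SE s -> SE u -> SE (fun N => s N + u N).
Proof.
  intros Hs Hu rho Hr. destruct (Hs rho Hr) as (B & N0 & HB & K).
  destruct (Hu rho Hr) as (B' & N0' & HB' & K').
  exists (B + B')%R, (Nat.max N0 N0'). split; [lra|]. intros N HN.
  specialize (K N ltac:(lia)). specialize (K' N ltac:(lia)).
  pose proof (Cmod_triangle (s N) (u N)). pose proof (pow_le rho N ltac:(lra)). nra.
Qed.

Lemma SE_mult s u : SE s -> EG u -> SE (fun N => s N * u N).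
Proof.
  intros Hs (rho' & B' & N0' & Hr' & HB' & K') rho Hr.
  (* Testing the decay of [s] at rho rho' absorbs the growth rho'^N of [u]. *)
  destruct (Hs (rho * rho')%R ltac:(nra)) as (B & N0 & HB & K).
  exists (B * B')%R, (Nat.max N0 N0'). split; [nra|]. intros N HN.
  specialize (K N ltac:(lia)). specialize (K' N ltac:(lia)).
  rewrite Cmod_mult. rewrite Rpow_mult_distr in K.
  pose proof (pow_le rho N ltac:(lra)). pose proof (pow_le rho' N ltac:(lra)).
  pose proof (Cmod_ge_0 (s N)). pose proof (Cmod_ge_0 (u N)).
  apply Rle_trans with (rho ^ N * Cmod (s N) * (B' * rho' ^ N))%R.
  - rewrite <- Rmult_assoc. apply Rmult_le_compat_l; [nra|assumption].
  - replace (rho ^ N * Cmod (s N) * (B' * rho' ^ N))%R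
      with (rho ^ N * rho' ^ N * Cmod (s N) * B')%R by ring.
    apply Rmult_le_compat_r; assumption.
Qed.

Lemma EG_const c : EG (fun _ => c).
Proof.
  exists 1%R, (Cmod c), O. repeat split; [lra|apply Cmod_ge_0|]. intros. rewrite pow1. lra.
Qed.

Lemma EG_geom (mu : C) : EG (fun N => mu ^ N).
Proof.
  exists (Cmod mu + 1)%R, 1%R, O. pose proof (Cmod_ge_0 mu). repeat split; try lra.
  intros N _. rewrite Cmod_pow, Rmult_1_l. apply pow_incr. lra.
Qed.

Lemma EG_plus s u : EG s -> EG u -> EG (fun N => s N + u N).
Proof.
  intros (r1 & B1 & N1 & Hr1 & HB1 & K1) (r2 & B2 & N2 & Hr2 & HB2 & K2).
  exists (Rmax r1 r2), (B1 + B2)%R, (Nat.max N1 N2).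
  pose proof (Rmax_l r1 r2). pose proof (Rmax_r r1 r2). repeat split; try lra.
  intros N HN. specialize (K1 N ltac:(lia)). specialize (K2 N ltac:(lia)).
  eapply Rle_trans; [apply Cmod_triangle|].
  assert (r1 ^ N <= Rmax r1 r2 ^ N)%R by (apply pow_incr; lra).
  assert (r2 ^ N <= Rmax r1 r2 ^ N)%R by (apply pow_incr; lra). nra.
Qed.

Lemma EG_mult s u : EG s -> EG u -> EG (fun N => s N * u N).
Proof.
  intros (r1 & B1 & N1 & Hr1 & HB1 & K1) (r2 & B2 & N2 & Hr2 & HB2 & K2).
  exists (r1 * r2)%R, (B1 * B2)%R, (Nat.max N1 N2). repeat split; try nra.
  intros N HN. specialize (K1 N ltac:(lia)). specialize (K2 N ltac:(lia)).
  rewrite Cmod_mult, Rpow_mult_distr.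
  replace (B1 * B2 * (r1 ^ N * r2 ^ N))%R with ((B1 * r1 ^ N) * (B2 * r2 ^ N))%R by ring.
  apply Rmult_le_compat; try assumption; apply Cmod_ge_0.
Qed.

Lemma EG_Csum (s : nat -> nat -> C) n : (forall i, (i < n)%nat -> EG (s i)) ->
  EG (fun N => Csum (fun i => s i N) n).
Proof.
  induction n; intros H; simpl; [apply EG_const|]. apply EG_plus; auto.
Qed.

Lemma SE_Csum (s : nat -> nat -> C) n : (forall i, (i < n)%nat -> SE (s i)) ->
  SE (fun N => Csum (fun i => s i N) n).
Proof.
  induction n; intros H; simpl.
  - intros rho Hr. exists 0%R, O. split; [lra|]. intros N _. rewrite Cmod_0. lra.
  - apply SE_plus; auto.
Qed.

Lemma SE_scal c s : SE s -> SE (fun N => c * s N).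
Proof.
  intros H. apply SE_ext with (fun N => s N * c).
  - exists O. intros. ring.
  - apply SE_mult; [assumption|apply EG_const].
Qed.

Lemma SE_shift s : SE s -> SE (fun N => s (S N)).
Proof.
  intros H rho Hr. destruct (H rho Hr) as (B & N0 & HB & K).
  exists (B / rho)%R, N0. split; [now apply Rdiv_le_0_compat|]. intros N HN.
  specialize (K (S N) ltac:(lia)). simpl in K.
  apply (Rmult_le_reg_l rho); [assumption|].
  replace (rho * (B / rho))%R with B by (field; lra). lra.
Qed.

Lemma SE_geom_zero b (mu : C) : mu <> 0 -> SE (fun N => b * mu ^ N) -> b = 0.
Proof.
  intros Hmu H. apply Cmod_gt_0 in Hmu.
  (* This rate cancels |mu|^N and leaves 2^N |b| bounded. *)
  destruct (H (2 / Cmod mu)%R ltac:(apply Rdiv_lt_0_compat; lra)) as (B & N0 & HB & K).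
  apply NNPP. intros Hb. apply Cmod_gt_0 in Hb.
  destruct (Pow_x_infinity 2 ltac:(rewrite Rabs_right; lra) (B / Cmod b + 1)%R) as [N1 HN1].
  specialize (HN1 (Nat.max N0 N1) ltac:(lia)). specialize (K (Nat.max N0 N1) ltac:(lia)).
  set (N := Nat.max N0 N1) in *.
  rewrite Rabs_right in HN1 by (apply Rle_ge, pow_le; lra).
  rewrite Cmod_mult, Cmod_pow in K.
  replace ((2 / Cmod mu) ^ N * (Cmod b * Cmod mu ^ N))%R with (2 ^ N * Cmod b)%R in K.
  - assert ((B / Cmod b + 1) * Cmod b <= 2 ^ N * Cmod b)%R by (apply Rmult_le_compat_r; lra).
    replace ((B / Cmod b + 1) * Cmod b)%R with (B + Cmod b)%R in H0 by (field; lra). lra.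
  - unfold Rdiv. rewrite Rpow_mult_distr, pow_inv. field. apply pow_nonzero. lra.
Qed.

(** * Exponential sums with distinct bases *)

Fixpoint esum (L : list (C * C)) (N : nat) : C :=
  match L with nil => 0 | (b, mu) :: L' => b * mu ^ N + esum L' N end.

Lemma esum_app L L' N : esum (L ++ L') N = esum L N + esum L' N.
Proof. induction L as [|[b mu] L IH]; simpl; [ring|]. rewrite IH. ring. Qed.

Lemma esum_SE_zero (L : list (C * C)) : NoDup (map snd L) -> (forall b mu, In (b, mu) L -> mu <> 0) ->
  SE (esum L) -> forall b mu, In (b, mu) L -> b = 0.
Proof.
  (* Strengthened so that the difference operator, which rescales the
     coefficients, stays inside the induction. *)
  assert (G : forall L : list (C * C), NoDup (map snd L) -> (forall b mu, In (b, mu) L -> mu <> 0) ->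
    forall g : C -> C, (forall b mu, In (b, mu) L -> g mu <> 0) ->
    SE (esum (map (fun p => (g (snd p) * fst p, snd p)) L)) ->
    forall b mu, In (b, mu) L -> b = 0).
  { clear L. intros L. induction L as [|[b0 mu0] L IH]; intros ND NZ g Hg H b mu HI; [destruct HI|].
    simpl in ND. inversion ND as [|? ? ND1 ND2]; subst.
    assert (Hm : forall b mu, In (b, mu) L -> mu - mu0 <> 0).
    { intros b1 mu1 H1 K. apply ND1. replace mu0 with mu1.
      - apply (in_map snd L (b1, mu1) H1).
      - rewrite <- (Cplus_0_l mu0), <- K. ring. }
    (* The operator s(N+1) - mu0 s(N) kills the term with base [mu0], multiplies every other one by
       the nonzero mu - mu0, and preserves superexponential decay. Once the others vanish, a single
       geometric sequence remains. *)
    assert (T : forall b mu, In (b, mu) L -> b = 0).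
    { apply (IH ND2) with (g := fun mu => (mu - mu0) * g mu).
      - intros. apply (NZ b1). now right.
      - intros b1 mu1 H1. apply Cmult_neq_0; [now apply (Hm b1)|apply (Hg b1); now right].
      - apply SE_ext with (fun N =>
          esum (map (fun p => (g (snd p) * fst p, snd p)) ((b0, mu0) :: L)) (S N)
          + - mu0 * esum (map (fun p => (g (snd p) * fst p, snd p)) ((b0, mu0) :: L)) N).
        + exists O. intros N _. simpl map. simpl esum.
          assert (D : forall L', esum (map (fun p => ((snd p - mu0) * g (snd p) * fst p, snd p)) L') N
             = esum (map (fun p => (g (snd p) * fst p, snd p)) L') (S N)
               - mu0 * esum (map (fun p => (g (snd p) * fst p, snd p)) L') N).
          { induction L' as [|[b1 mu1] L' IHL]; simpl; [ring|]. rewrite IHL. ring. }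
          rewrite D. ring.
        + apply SE_plus; [now apply SE_shift|now apply SE_scal]. }
    destruct HI as [E|HI]; [|now apply (T b mu)]. inversion E; subst.
    assert (Z : g mu * b = 0).
    { apply (SE_geom_zero _ mu).
      - apply (NZ b). now left.
      - apply SE_ext with (2 := H). exists O. intros N _. simpl.
        replace (esum (map (fun p => (g (snd p) * fst p, snd p)) L) N) with (RtoC 0); [ring|].
        clear - T. symmetry. induction L as [|[b1 mu1] L IH]; simpl; [reflexivity|].
        rewrite (T b1 mu1) by now left. rewrite IH; [ring|]. intros. apply (T b mu). now right. }
    apply Cmult_integral in Z. destruct Z as [Z|Z]; [|assumption].
    exfalso. revert Z. apply (Hg b). now left. }
  intros ND NZ H. apply (G L ND NZ (fun _ => 1)).
  - intros b mu _ K. apply RtoC_inj in K. lra.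
  - apply SE_ext with (2 := H). exists O. intros N _. clear.
    induction L as [|[b mu] L IH]; simpl; [reflexivity|]. rewrite <- IH. ring.
Qed.

(** * Combinations of rational functions along the orbit q^N z *)

Section Orbit.
Variables q z : C.
Hypothesis Hq : (1 < Cmod q)%R.
Hypothesis Hz : z <> 0.

(* The exponential terms of N |-> c * mu^N * ev p (q^N z). *)
Fixpoint terms (p : list C) (mu c : C) : list (C * C) :=
  match p with nil => nil | a :: p' => (a * c, mu) :: terms p' (mu * q) (c * z) end.

Lemma esum_terms p mu c N : esum (terms p mu c) N = c * mu ^ N * ev p (q ^ N * z).
Proof.
  revert mu c. induction p as [|a p IH]; intros; simpl; [ring|].
  rewrite IH, Cpow_mult_l. ring.
Qed.

Lemma terms_snd p mu c b nu : In (b, nu) (terms p mu c) -> exists m, nu = mu * q ^ m.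
Proof.
  revert mu c. induction p as [|a p IH]; intros mu c H; [destruct H|].
  destruct H as [E|H].
  - inversion E. exists O. simpl. ring.
  - destruct (IH _ _ H) as [m ->]. exists (S m). rewrite Cpow_S. ring.
Qed.

Lemma Cmod_pow_inj m m' : (Cmod q ^ m = Cmod q ^ m')%R -> m = m'.
Proof.
  intros E. destruct (Nat.lt_trichotomy m m') as [L|[L|L]]; [|assumption|];
    pose proof (Rlt_pow (Cmod q) _ _ Hq L); lra.
Qed.

Lemma terms_NoDup p (mu c : C) : mu <> 0 -> NoDup (map snd (terms p mu c)).
Proof.
  pose proof (Cmod_gt_1_neq_0 q Hq) as Hq0.
  revert mu c. induction p as [|a p IH]; intros mu c Hmu; simpl; constructor.
  - intros H. apply in_map_iff in H. destruct H as [[b nu] [E H]]. simpl in E. subst nu.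
    destruct (terms_snd _ _ _ _ _ H) as [m E]. apply (f_equal Cmod) in E.
    rewrite !Cmod_mult, Cmod_pow in E. apply Cmod_gt_0 in Hmu.
    assert (K : (Cmod q ^ 0 = Cmod q ^ S m)%R).
    { apply (Rmult_eq_reg_l (Cmod mu)); [simpl; lra|lra]. }
    apply Cmod_pow_inj in K. discriminate.
  - apply IH. now apply Cmult_neq_0.
Qed.

Lemma terms_zero p (mu c : C) : c <> 0 ->
  (forall b nu, In (b, nu) (terms p mu c) -> b = 0) -> zero_list p.
Proof.
  revert mu c. induction p as [|a p IH]; intros mu c Hc H; [intros b []|].
  intros b [<-|Hb].
  - specialize (H (a * c) mu (or_introl eq_refl)). apply Cmult_integral in H.
    now destruct H.
  - apply (IH (mu * q) (c * z)); [now apply Cmult_neq_0| |assumption].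
    intros b' nu H'. apply (H b' nu). now right.
Qed.

Fixpoint all_terms (eta : nat -> C) (r : nat -> list C) (n : nat) : list (C * C) :=
  match n with O => nil | S m => all_terms eta r m ++ terms (r m) (eta m) 1 end.

Lemma all_terms_In eta r n b nu : In (b, nu) (all_terms eta r n) ->
  exists i, (i < n)%nat /\ In (b, nu) (terms (r i) (eta i) 1).
Proof.
  induction n; intros H; [destruct H|]. apply in_app_or in H. destruct H as [H|H].
  - destruct (IHn H) as [i [Hi K]]. exists i. split; [lia|assumption].
  - exists n. split; [lia|assumption].
Qed.

Lemma In_all_terms eta r n i b nu : (i < n)%nat -> In (b, nu) (terms (r i) (eta i) 1) ->
  In (b, nu) (all_terms eta r n).
Proof.
  induction n; intros Hi H; [lia|]. apply in_or_app.
  destruct (Nat.eq_dec i n) as [->|]; [now right|left; apply IHn; [lia|assumption]].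
Qed.

(** The bases eta_i q^m are pairwise distinct: since |eta_i| = 1 and |q| > 1 the modulus determines
    m, and then the base determines eta_i, hence i. *)
Lemma polynomial_combination (eta : nat -> C) (r : nat -> list C) n :
  (forall i, (i < n)%nat -> Cmod (eta i) = 1%R) ->
  (forall i j, (i < j < n)%nat -> eta i <> eta j) ->
  SE (fun N => Csum (fun i => eta i ^ N * ev (r i) (q ^ N * z)) n) ->
  forall i, (i < n)%nat -> zero_list (r i).
Proof.
  intros H1 Hne HS i Hi. pose proof (Cmod_gt_1_neq_0 q Hq) as Hq0.
  assert (one0 : RtoC 1 <> 0) by (intros K; apply RtoC_inj in K; lra).
  assert (H0 : forall i, (i < n)%nat -> eta i <> 0).
  { intros j Hj. apply Cmod_gt_0. rewrite H1 by assumption. lra. }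
  apply (terms_zero (r i) (eta i) 1 one0). intros b nu HI.
  apply (esum_SE_zero (all_terms eta r n)) with (mu := nu).
  - clear i Hi b nu HI HS. induction n; simpl; [constructor|].
    rewrite map_app. apply NoDup_app.
    + apply IHn; intros; [apply H1|apply Hne|apply H0]; lia.
    + apply terms_NoDup, H0. lia.
    + intros x Hx Hx'. apply in_map_iff in Hx. apply in_map_iff in Hx'.
      destruct Hx as [[b x1] [E1 K1]]. destruct Hx' as [[b' x2] [E2 K2]].
      simpl in E1, E2. subst x1 x2.
      destruct (all_terms_In _ _ _ _ _ K1) as (i & Hi & K3).
      destruct (terms_snd _ _ _ _ _ K3) as [m Em].
      destruct (terms_snd _ _ _ _ _ K2) as [m' Em'].
      rewrite Em in Em'. pose proof (f_equal Cmod Em') as E.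
      rewrite !Cmod_mult, !Cmod_pow, (H1 i), (H1 n), !Rmult_1_l in E by lia.
      apply Cmod_pow_inj in E. subst m'.
      apply (Hne i n ltac:(lia)).
      transitivity (eta i * q ^ m * / q ^ m); [|rewrite Em'];
        field; now apply Cpow_nz.
  - intros b' nu' H'. destruct (all_terms_In _ _ _ _ _ H') as (j & Hj & K).
    destruct (terms_snd _ _ _ _ _ K) as [m ->].
    apply Cmult_neq_0; [now apply H0|now apply Cpow_nz].
  - apply SE_ext with (2 := HS). exists O. intros N _. clear - n.
    induction n; simpl; [reflexivity|]. rewrite esum_app, esum_terms, <- IHn. ring.
  - now apply In_all_terms with i.
Qed.

Lemma orbit_escapes (R0 : R) : exists N0, forall N, (N0 <= N)%nat -> (R0 <= Cmod (q ^ N * z))%R.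
Proof.
  apply Cmod_gt_0 in Hz as Pz.
  destruct (Pow_x_infinity (Cmod q) ltac:(rewrite Rabs_right; lra) (R0 / Cmod z)%R) as [N0 HN].
  exists N0. intros N H. specialize (HN N H).
  rewrite Rabs_right in HN by (apply Rle_ge, pow_le; lra).
  rewrite Cmod_mult, Cmod_pow.
  apply Rge_le, (Rmult_le_compat_r (Cmod z)) in HN; [|lra].
  replace (R0 / Cmod z * Cmod z)%R with R0 in HN by (field; lra). lra.
Qed.

Lemma ev_eventually_neq_0 p : ~ zero_list p ->
  exists N0, forall N, (N0 <= N)%nat -> ev p (q ^ N * z) <> 0.
Proof.
  intros H. destruct (ev_lower_bound p H) as (c & R0 & Hc & K).
  destruct (orbit_escapes R0) as [N0 HN]. exists N0. intros N HN'.
  apply Cmod_gt_0. specialize (K _ (HN N HN')). lra.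
Qed.

Lemma EG_ev p : EG (fun N => ev p (q ^ N * z)).
Proof.
  induction p as [|a p IH]; simpl; [apply EG_const|].
  apply EG_plus; [apply EG_const|]. apply EG_mult; [|assumption].
  apply EG_mult; [apply EG_geom|apply EG_const].
Qed.

Lemma EG_inv_ev p : ~ zero_list p -> EG (fun N => / ev p (q ^ N * z)).
Proof.
  intros H. destruct (ev_lower_bound p H) as (c & R0 & Hc & K).
  destruct (orbit_escapes R0) as [N0 HN]. exists 1%R, (/ c)%R, N0.
  repeat split; [lra|left; now apply Rinv_0_lt_compat|]. intros N HN'.
  specialize (K _ (HN N HN')). rewrite pow1, Rmult_1_r, Cmod_inv.
  - now apply Rinv_le_contravar.
  - apply Cmod_gt_0. lra.
Qed.

(** Multiplying by the product of all denominators preserves superexponential decay, since a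
    polynomial grows at most exponentially along the orbit. This reduces to polynomials c_i p_i
    times the product of the other denominators. *)
Lemma rational_combination (eta c : nat -> C) (p d : nat -> list C) n :
  (forall i, (i < n)%nat -> Cmod (eta i) = 1%R) ->
  (forall i j, (i < j < n)%nat -> eta i <> eta j) ->
  (forall i, (i < n)%nat -> ~ zero_list (d i)) ->
  SE (fun N => Csum (fun i => eta i ^ N *
        (c i * (ev (p i) (q ^ N * z) / ev (d i) (q ^ N * z)))) n) ->
  forall i, (i < n)%nat -> c i = 0 \/ zero_list (p i).
Proof.
  intros H1 Hne Hd HS i Hi.
  set (others := fun i => pprod (fun j => if Nat.eqb j i then RtoC 1 :: nil else d j) n).
  set (r := fun i => pscal (c i) (pmul (p i) (others i))).
  assert (Hev : exists N0, forall N j, (N0 <= N)%nat -> (j < n)%nat -> ev (d j) (q ^ N * z) <> 0).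
  { clear - Hd Hq Hz. induction n; [exists O; intros; lia|].
    destruct IHn as [N1 K1]; [auto|].
    destruct (ev_eventually_neq_0 (d n)) as [N2 K2]; [apply Hd; lia|].
    exists (Nat.max N1 N2). intros N j HN Hj.
    destruct (Nat.eq_dec j n) as [->|]; [apply K2; lia|apply K1; lia]. }
  destruct Hev as [N0 Hev].
  assert (Eo : forall i x, (i < n)%nat ->
     ev (pprod d n) x = ev (d i) x * ev (others i) x).
  { intros i0 x Hi0. unfold others. rewrite !ev_pprod, (Cprod_split _ n i0 Hi0).
    f_equal. apply Cprod_ext. intros j _. destruct (Nat.eqb j i0); simpl; [ring|reflexivity]. }
  assert (Zr : zero_list (r i)).
  { revert i Hi. apply (polynomial_combination eta r n H1 Hne).
    apply SE_ext with (fun N => Csum (fun i => eta i ^ N *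
        (c i * (ev (p i) (q ^ N * z) / ev (d i) (q ^ N * z)))) n * ev (pprod d n) (q ^ N * z)).
    - exists N0. intros N HN. rewrite Cmult_comm, <- Csum_scal. apply Csum_ext.
      intros i Hi. unfold r. rewrite ev_pscal, ev_pmul, (Eo i _ Hi). field. now apply Hev.
    - apply SE_mult; [assumption|apply EG_ev]. }
  destruct (classic (c i = 0)) as [|Hc]; [now left|right].
  (* The factor [p i] is isolated by evaluating at one point far along the orbit, where all
     denominators are nonzero and [p i], if nonzero, would be too. *)
  apply NNPP. intros Hp. destruct (ev_eventually_neq_0 _ Hp) as [N1 K1].
  pose proof (ev_zero_list _ (q ^ (Nat.max N0 N1) * z) Zr) as E.
  unfold r in E. rewrite ev_pscal, ev_pmul in E.
  apply Cmult_integral in E. destruct E as [E|E]; [contradiction|].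
  apply Cmult_integral in E. destruct E as [E|E].
  - revert E. apply K1. lia.
  - revert E. unfold others. rewrite ev_pprod. apply Cprod_neq_0. intros j Hj.
    destruct (Nat.eqb j i); [|apply Hev; [lia|assumption]].
    simpl. replace (1 + _) with (RtoC 1) by ring. intros K. apply RtoC_inj in K. lra.
Qed.

(** Divide the relation by w^n: the top coefficient becomes a combination of the lower ones with
    weights w^(d-n). These decay faster than any exponential and overpower the exponential growth of
    the lower coefficients. *)
Lemma top_degree_SE (w : nat -> C) (E : nat -> nat -> C) n :
  (forall N, w N <> 0) -> SE (fun N => / w N) ->
  (forall d, (d < n)%nat -> EG (E d)) ->
  eventually_eq (fun N => Csum (fun d => w N ^ d * E d N) (S n)) (fun _ => 0) -> SE (E n).
Proof.
  intros Hw HS HE [N0 H].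
  assert (HP : forall k, SE (fun N => (/ w N) ^ S k)).
  { induction k.
    - apply SE_ext with (2 := HS). exists O. intros. simpl. ring.
    - apply (SE_mult (fun N => / w N) (fun N => (/ w N) ^ S k) HS).
      now apply SE_EG. }
  apply SE_ext with (fun N => Csum (fun d => - (1) * ((/ w N) ^ (n - d) * E d N)) n).
  - exists N0. intros N HN. specialize (H N HN). simpl in H.
    assert (Hwn : w N ^ n <> 0) by now apply Cpow_nz.
    assert (K : w N ^ n * Csum (fun d => - (1) * ((/ w N) ^ (n - d) * E d N)) n
              = - Csum (fun d => w N ^ d * E d N) n).
    { rewrite <- Csum_scal. transitivity (- (1) * Csum (fun d => w N ^ d * E d N) n); [|ring].
      rewrite <- Csum_scal. apply Csum_ext. intros d Hd.
      replace (w N ^ n) with (w N ^ d * w N ^ (n - d)) by (rewrite <- Cpow_add_r; f_equal; lia).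
      rewrite Cpow_inv by apply Hw. field. now apply Cpow_nz. }
    assert (K2 : w N ^ n * Csum (fun d => - (1) * ((/ w N) ^ (n - d) * E d N)) n = w N ^ n * E n N).
    { rewrite K. transitivity (- (Csum (fun d => w N ^ d * E d N) n + w N ^ n * E n N) + w N ^ n * E n N);
        [ring|]. rewrite H. ring. }
    apply (f_equal (fun v => / w N ^ n * v)) in K2.
    rewrite !Cmult_assoc, Cinv_l, !Cmult_1_l in K2 by assumption. exact K2.
  - apply SE_Csum. intros d Hd. apply SE_scal. apply SE_mult; [|now apply HE].
    replace (n - d)%nat with (S (n - d - 1)) by lia. apply HP.
Qed.

Lemma graded_combination (w : nat -> C) (m : nat -> nat) (eta c : nat -> nat -> C)
    (p den : nat -> nat -> list C) n :
  (forall N, w N <> 0) -> SE (fun N => / w N) ->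
  (forall d i, (d < n)%nat -> (i < m d)%nat -> Cmod (eta d i) = 1%R) ->
  (forall d i j, (d < n)%nat -> (i < j < m d)%nat -> eta d i <> eta d j) ->
  (forall d i, (d < n)%nat -> (i < m d)%nat -> ~ zero_list (den d i)) ->
  eventually_eq (fun N => Csum (fun d => w N ^ d * Csum (fun i => eta d i ^ N *
        (c d i * (ev (p d i) (q ^ N * z) / ev (den d i) (q ^ N * z)))) (m d)) n) (fun _ => 0) ->
  forall d i, (d < n)%nat -> (i < m d)%nat -> c d i = 0 \/ zero_list (p d i).
Proof.
  intros Hw HS. induction n; intros H1 Hne Hd H; [intros; lia|].
  set (E := fun d N => Csum (fun i => eta d i ^ N *
        (c d i * (ev (p d i) (q ^ N * z) / ev (den d i) (q ^ N * z)))) (m d)).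
  assert (HT : SE (E n)).
  { apply (top_degree_SE w E n Hw HS); [|exact H]. intros d Hdn. unfold E.
    apply EG_Csum. intros i Hi. apply EG_mult; [apply EG_geom|].
    apply EG_mult; [apply EG_const|]. apply EG_mult; [apply EG_ev|].
    apply EG_inv_ev, Hd; [lia|assumption]. }
  assert (Top : forall i, (i < m n)%nat -> c n i = 0 \/ zero_list (p n i)).
  { apply (rational_combination (eta n) (c n) (p n) (den n) (m n)); auto. }
  assert (Z : forall N, E n N = 0).
  { intros N. unfold E. rewrite <- (Csum_0 (m n)). apply Csum_ext. intros i Hi.
    destruct (Top i Hi) as [-> | K]; [ring|]. rewrite (ev_zero_list _ _ K).
    unfold Cdiv. ring. }
  intros d i Hdn Hi. destruct (Nat.eq_dec d n) as [->|]; [now apply Top|].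
  apply IHn; auto; [|lia]. destruct H as [N0 H]. exists N0. intros N HN.
  specialize (H N HN). simpl in H. fold (E n N) in H. rewrite Z in H.
  rewrite <- H. ring.
Qed.

End Orbit.

(** * Theta and the coefficients along the orbit *)

(** The product of the -q^j z for 1 <= j <= N, by which theta is multiplied between z and q^N z. It
    does not involve the dilation u of [theta_orbit], which enters only through u^N, so all theta
    (zeta^i z) share one growth factor. *)
Fixpoint theta_factor (q z : C) (N : nat) : C :=
  match N with O => 1 | S M => - (q * (q ^ M * z)) * theta_factor q z M end.

Lemma theta_orbit (q z u : C) N : (1 < Cmod q)%R -> z <> 0 -> u <> 0 ->
  theta q (u * (q ^ N * z)) = u ^ N * theta_factor q z N * theta q (u * z).
Proof.
  intros Hq Hz Hu. pose proof (Cmod_gt_1_neq_0 q Hq) as Hq0.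
  induction N.
  - simpl. rewrite !Cmult_1_l. reflexivity.
  - replace (u * (q ^ S N * z)) with (q * (u * (q ^ N * z))) by (rewrite Cpow_S; ring).
    rewrite theta_shift, IHN by
      (try assumption; repeat apply Cmult_neq_0; try assumption; now apply Cpow_nz).
    simpl theta_factor. rewrite Cpow_S. ring.
Qed.

Lemma theta_factor_neq_0 (q z : C) N : q <> 0 -> z <> 0 -> theta_factor q z N <> 0.
Proof.
  intros Hq Hz. induction N; simpl.
  - intros K. apply RtoC_inj in K. lra.
  - apply Cmult_neq_0; [|assumption]. intros K.
    apply (Cmult_neq_0 q (q ^ N * z)); [assumption| |].
    + apply Cmult_neq_0; [now apply Cpow_nz|assumption].
    + transitivity (- - (q * (q ^ N * z))); [ring|]. rewrite K. ring.
Qed.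

(** Consecutive terms of rho^N / |w_N| have ratio rho / (|q| |q^N z|), which is at most 1 once the
    orbit has left the disc of radius rho; the sequence is then nonincreasing. *)
Lemma SE_inv_theta_factor (q z : C) : (1 < Cmod q)%R -> z <> 0 ->
  SE (fun N => / theta_factor q z N).
Proof.
  intros Hq Hz rho Hr. pose proof (Cmod_gt_1_neq_0 q Hq) as Hq0.
  destruct (orbit_escapes q z Hq Hz rho) as [N0 HN0].
  set (a := fun N => (rho ^ N * Cmod (/ theta_factor q z N))%R).
  assert (Ha : forall N, (0 <= a N)%R).
  { intros N. apply Rmult_le_pos; [apply pow_le; lra|apply Cmod_ge_0]. }
  exists (a N0), N0. split; [apply Ha|]. intros N HN. fold (a N).
  induction HN; [lra|]. apply Rle_trans with (a m); [|assumption].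
  specialize (HN0 m HN). specialize (Ha m).
  assert (Hw : theta_factor q z m <> 0) by now apply theta_factor_neq_0.
  assert (Hx : q ^ m * z <> 0) by (apply Cmult_neq_0; [now apply Cpow_nz|assumption]).
  assert (Pw := proj1 (Cmod_gt_0 _) Hw). assert (Px := proj1 (Cmod_gt_0 _) Hx).
  assert (E : a (S m) = (a m * (rho / (Cmod q * Cmod (q ^ m * z))))%R).
  { unfold a. rewrite !Cmod_inv by now apply theta_factor_neq_0.
    simpl theta_factor. rewrite Cmod_mult, Cmod_opp, (Cmod_mult q). simpl pow.
    field. repeat split; lra. }
  rewrite E. rewrite <- (Rmult_1_r (a m)) at 2. apply Rmult_le_compat_l; [assumption|].
  apply (Rmult_le_reg_r (Cmod q * Cmod (q ^ m * z))); [nra|].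
  replace (rho / (Cmod q * Cmod (q ^ m * z)) * (Cmod q * Cmod (q ^ m * z)))%R with rho
    by (field; lra).
  nra.
Qed.

Lemma poly_eval_orbit (l : list (C -> C)) (z x : C) : (forall a, In a l -> a x = a z) ->
  poly_eval l x = ev (map (fun a => a z) l) x.
Proof.
  intros H. unfold poly_eval.
  (* The starting exponent is generalised because [poly_eval_aux] raises it at each coefficient,
     whereas [ev] is in Horner form. *)
  assert (G : forall i, poly_eval_aux l i x = x ^ i * ev (map (fun a => a z) l) x).
  { induction l as [|a l IH]; intros i; simpl; [ring|].
    rewrite IH, (H a) by (try (now left); intros; apply H; now right).
    to_Cpow. rewrite Cpow_S. ring. }
  rewrite G. simpl. ring.
Qed.

Lemma in_k_generic_orbit (q : C) a : q <> 0 -> in_k q a ->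
  generic (fun z => forall N, a (q ^ N * z) = a z).
Proof.
  intros Hq [_ H].
  apply generic_impl with (2 := mer_eq_generic_orbit _ _ q Hq H).
  intros z _ K N. induction N.
  - f_equal. simpl. ring.
  - rewrite <- IHN, <- (K N). f_equal. rewrite Cpow_S. ring.
Qed.

(** * Nonvanishing conditions on balls *)

(** Used for conditions that survive on a smaller ball, so that finitely many can be imposed in turn
    before a generic point is picked. *)
Definition open_dense (P : C -> Prop) : Prop :=
  forall (z : C) (r : R), (0 < r)%R -> exists (z' : C) (r' : R), (0 < r')%R /\
    forall w, (Cmod (w - z') < r')%R -> (Cmod (w - z) < r)%R /\ P w.

Lemma open_dense_forall_lt (P : nat -> C -> Prop) n :
  (forall i, (i < n)%nat -> open_dense (P i)) ->
  open_dense (fun w => forall i, (i < n)%nat -> P i w).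
Proof.
  induction n; intros H z r Hr.
  - exists z, r. split; [assumption|]. intros w Hw. split; [assumption|]. intros; lia.
  - destruct (IHn ltac:(auto) z r Hr) as (z1 & r1 & Hr1 & H1).
    destruct (H n ltac:(lia) z1 r1 Hr1) as (z2 & r2 & Hr2 & H2).
    exists z2, r2. split; [assumption|]. intros w Hw. destruct (H2 w Hw) as [H3 H4].
    destruct (H1 w H3) as [H5 H6]. split; [assumption|]. intros i Hi.
    destruct (Nat.eq_dec i n) as [->|]; [assumption|]. apply H6. lia.
Qed.

Lemma meromorphic_open_dense f : meromorphic_Cstar f -> ~ mer_eq f (fun _ => 0) ->
  open_dense (fun w => f w <> 0).
Proof.
  intros Hf Hn z r Hr.
  destruct (meromorphic_nonvanishing_subball f z r Hf Hn Hr) as (z' & r' & Hr' & H).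
  exists z', r'. split; [assumption|]. intros w Hw. destruct (H w Hw) as (? & _ & ?). tauto.
Qed.

Lemma denominator_open_dense q PQ : rat_over_k q PQ ->
  open_dense (fun w => ~ zero_list (map (fun a : C -> C => a w) (snd PQ))).
Proof.
  intros (_ & HQ & Hn) z r Hr.
  apply not_all_ex_not in Hn. destruct Hn as [b Hb]. apply imply_to_and in Hb.
  destruct Hb as [Hb1 Hb2]. destruct (HQ b Hb1) as [Mb _].
  destruct (meromorphic_open_dense b Mb Hb2 z r Hr) as (z' & r' & Hr' & H).
  exists z', r'. split; [assumption|]. intros w Hw. destruct (H w Hw) as [H1 H2].
  split; [assumption|]. intros K. apply H2, K.
  now apply (in_map (fun a : C -> C => a w)).
Qed.

(** One ball suffices, since it is the coefficients of the relation to which the identity theorem is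
    applied; continuity of theta then does the rest. *)
Lemma theta_nonvanishing_ball (q u : C) : (1 < Cmod q)%R -> u <> 0 ->
  exists (z : C) (r : R), (0 < r)%R /\
    forall w, (Cmod (w - z) < r)%R -> theta q (u * w) <> 0.
Proof.
  intros Hq Hu. destruct (theta_nonzero q Hq) as (y & Hy & Hty).
  exists (y / u).
  assert (E : u * (y / u) = y) by (field; assumption).
  apply (Ccont_neq0 (fun w => theta q (u * w))).
  - apply (Ccont_comp (theta q) (fun w => u * w)).
    + apply Ccont_mult; [apply Ccont_const|apply Ccont_id].
    + rewrite E. now apply theta_cont.
  - now rewrite E.
Qed.

Lemma sum_n_Csum (f : nat -> C) n : sum_n f n = Csum f (S n).
Proof.
  induction n.
  - rewrite sum_O. simpl. ring.
  - rewrite sum_Sn, IHn. reflexivity.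
Qed.

Lemma sum_n_m_Csum (f : nat -> C) n : sum_n_m f 1 n = Csum (fun d => f (S d)) n.
Proof.
  induction n.
  - rewrite sum_n_m_zero by lia. reflexivity.
  - rewrite sum_n_Sm by lia. rewrite IHn. reflexivity.
Qed.

(** * Roots of unity and the independence theorem *)

Lemma primitive_root_Cmod t (zeta : C) : (0 < t)%nat -> primitive_root t zeta -> Cmod zeta = 1%R.
Proof.
  intros Ht [H _]. rewrite Cpw_pow in H. apply (f_equal Cmod) in H.
  rewrite Cmod_pow, Cmod_1 in H. apply pow_R1 in H. destruct H as [H|H]; [|lia].
  rewrite Rabs_right in H by (apply Rle_ge, Cmod_ge_0). assumption.
Qed.

(** Equality would make t divide (j - i) d; being prime, t would divide one of the factors, but both
    lie strictly between 0 and t. *)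
Lemma primitive_root_powers_distinct t (zeta : C) d i j : prime (Z.of_nat t) ->
  primitive_root t zeta -> (0 < d < t)%nat -> (i < j < t)%nat ->
  zeta ^ (i * d) <> zeta ^ (j * d).
Proof.
  intros Hp Hz Hd Hij E. pose proof (primitive_root_Cmod t zeta ltac:(lia) Hz) as M.
  destruct Hz as [H1 H2]. rewrite Cpw_pow in H1.
  assert (Z0 : zeta <> 0) by (apply Cmod_gt_0; lra).
  assert (K : zeta ^ ((j - i) * d) = 1).
  { transitivity (zeta ^ ((j - i) * d) * zeta ^ (i * d) * / zeta ^ (i * d)).
    - field. now apply Cpow_nz.
    - rewrite <- Cpow_add_r. replace ((j - i) * d + i * d)%nat with (j * d)%nat by nia.
      rewrite <- E. apply Cinv_r. now apply Cpow_nz. }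
  set (e := ((j - i) * d)%nat) in *.
  assert (R : zeta ^ (e mod t) = 1).
  { rewrite (Nat.div_mod_eq e t), Cpow_add_r, Cpow_mult_r, H1, Cpow_1_l, Cmult_1_l in K.
    exact K. }
  destruct (Nat.eq_dec (e mod t) 0) as [E0|N0].
  - apply Nat.Lcm0.mod_divide in E0. destruct E0 as [k Hk].
    assert (D : (Z.of_nat t | Z.of_nat (j - i) * Z.of_nat d)%Z).
    { exists (Z.of_nat k). unfold e in Hk. nia. }
    apply prime_mult in D; [|assumption]. destruct D as [D|D]; apply Z.divide_pos_le in D; lia.
  - apply (H2 (e mod t)%nat); [|rewrite Cpw_pow; exact R].
    pose proof (Nat.mod_upper_bound e t ltac:(lia)). lia.
Qed.

Theorem theorem5 (t : nat) (zeta q : C)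
  (lam0 : list (C -> C) * list (C -> C))
  (lam : nat -> nat -> list (C -> C) * list (C -> C)) :
  prime (Z.of_nat t) ->
  primitive_root t zeta ->
  (1 < Cmod q)%R ->
  rat_over_k q lam0 ->
  (forall i d : nat, (i < t)%nat -> (1 <= d <= t - 1)%nat -> rat_over_k q (lam i d)) ->
  mer_eq
    (fun z => rat_eval lam0 z +
       sum_n_m (fun d => sum_n (fun i => rat_eval (lam i d) z *
                                   Cpw (theta q (Cpw zeta i * z)) d) (t - 1))
               1 (t - 1))
    (fun _ => 0) ->
  rat_zero lam0 /\
  (forall i d : nat, (i < t)%nat -> (1 <= d <= t - 1)%nat -> rat_zero (lam i d)).
Proof.
  intros Hp Hzeta Hq H0 Hlam Hrel.
  pose proof (Cmod_gt_1_neq_0 q Hq) as Hq0.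
  assert (Ht : (2 <= t)%nat) by (apply prime_ge_2 in Hp; lia).
  pose proof (primitive_root_Cmod t zeta ltac:(lia) Hzeta) as Mz.
  assert (Z0 : zeta <> 0) by (apply Cmod_gt_0; lra).
  (* The constant term becomes the summand of degree 0, with a single index i = 0. *)
  set (L := fun d i => match d with O => lam0 | S _ => lam i d end).
  set (m := fun d : nat => match d with O => 1%nat | S _ => t end).
  set (eta := fun d i => zeta ^ (i * d)).
  set (c := fun (z : C) d i => theta q (zeta ^ i * z) ^ d).
  assert (HL : forall d i, (d < t)%nat -> (i < m d)%nat -> rat_over_k q (L d i)).
  { intros [|d] i Hd Hi; simpl in *; [assumption|]. apply Hlam; lia. }
  assert (Orb : forall PQ, rat_over_k q PQ ->
    generic (fun z => forall N, rat_eval PQ (q ^ N * z) =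
      ev (map (fun a => a z) (fst PQ)) (q ^ N * z) / ev (map (fun a => a z) (snd PQ)) (q ^ N * z))).
  { intros PQ (HP & HQ & _).
    apply generic_impl with (fun z =>
      (forall a, In a (fst PQ) -> forall N, a (q ^ N * z) = a z) /\
      (forall a, In a (snd PQ) -> forall N, a (q ^ N * z) = a z)).
    - intros z _ [K1 K2] N. unfold rat_eval. now rewrite !(poly_eval_orbit _ z) by auto.
    - apply generic_and; apply generic_forall_In; intros a Ha;
        apply in_k_generic_orbit; auto. }
  (* The nonvanishing of the denominators stays a premise inside the generic statement; it is
     supplied later on a ball. *)
  assert (G : generic (fun z => forall d, (d < t)%nat -> forall i, (i < m d)%nat ->
     (forall d i, (d < t)%nat -> (i < m d)%nat ->
        ~ zero_list (map (fun a => a z) (snd (L d i)))) ->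
     c z d i = 0 \/ zero_list (map (fun a => a z) (fst (L d i))))).
  { apply generic_impl with (2 := generic_and _ _
      (mer_eq_generic_orbit _ _ q Hq0 Hrel)
      (generic_forall_lt _ t (fun d Hd => generic_forall_lt _ (m d)
        (fun i Hi => Orb (L d i) (HL d i Hd Hi))))).
    intros z Hz [Krel Kev] d Hd i Hi Hden.
    apply (graded_combination q z Hq Hz (theta_factor q z) m eta (c z)
      (fun d i => map (fun a => a z) (fst (L d i)))
      (fun d i => map (fun a => a z) (snd (L d i))) t); auto.
    - intros N. now apply theta_factor_neq_0.
    - now apply SE_inv_theta_factor.
    - intros d' i' _ _. unfold eta. rewrite Cmod_pow, Mz. apply pow1.
    (* In degree 0 there is a single index, so no pair has to be separated. *)
    - intros d' i' j' Hd' Hij. unfold m in Hij. destruct d' as [|d']; [lia|].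
      apply primitive_root_powers_distinct with t; auto; lia.
    - exists O. intros N _. rewrite <- (Krel N).
      rewrite sum_n_m_Csum. replace t with (S (t - 1)) at 1 by lia.
      rewrite Csum_Sn_l. f_equal.
      + simpl m. simpl Csum. unfold eta, c.
        change lam0 with (L O O).
        rewrite (Kev O ltac:(lia) O ltac:(simpl; lia) N).
        rewrite Nat.mul_0_r. simpl. rewrite Cpow_1_l. ring.
      + apply Csum_ext. intros k Hk. rewrite sum_n_Csum.
        replace (S (t - 1)) with t by lia.
        rewrite <- Csum_scal. apply Csum_ext. intros j Hj.
        rewrite <- (Kev (S k) ltac:(lia) j Hj N).
        (* With d = k + 1, the power theta (zeta^j q^N z)^d splits into zeta^(j d N), w_N^d and
           theta (zeta^j z)^d, which are the base, the growth factor and the constant of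
           [graded_combination]. *)
        to_Cpow. rewrite theta_orbit by (auto; now apply Cpow_nz).
        rewrite !Cpow_mult_l. unfold eta, c.
        rewrite <- !Cpow_mult_r. replace (j * (N * S k))%nat with (j * S k * N)%nat by ring.
        change (L (S k) j) with (lam j (S k)). ring. }
  assert (Main : forall d i, (d < t)%nat -> (i < m d)%nat -> rat_zero (L d i)).
  (* If a numerator coefficient [a] were not identically 0, nested balls would give a region where
     the theta factor, [a] and all denominators are nonzero; a generic point in it contradicts
     [G]. *)
  { intros d i Hd Hi a Ha. apply NNPP. intros Hna.
    destruct (theta_nonvanishing_ball q (zeta ^ i) Hq ltac:(now apply Cpow_nz))
      as (z1 & r1 & Hr1 & N1).
    assert (Ma : meromorphic_Cstar a) by (destruct (HL d i Hd Hi) as (HP & _); now apply HP).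
    destruct (meromorphic_open_dense a Ma Hna z1 r1 Hr1) as (z2 & r2 & Hr2 & N2).
    destruct (open_dense_forall_lt _ t (fun d Hd => open_dense_forall_lt _ (m d)
       (fun i Hi => denominator_open_dense q (L d i) (HL d i Hd Hi))) z2 r2 Hr2)
      as (z3 & r3 & Hr3 & N3).
    destruct (generic_dense _ z3 r3 G Hr3) as (w & Hw & Hw0 & Gw).
    destruct (N3 w Hw) as [W2 Wden]. destruct (N2 w W2) as [W1 Wa].
    destruct (Gw d Hd i Hi) as [K|K].
    - intros d' i' Hd' Hi'. now apply Wden.
    - revert K. apply Cpow_nz. now apply N1.
    - apply Wa, K. now apply (in_map (fun a : C -> C => a w)). }
  split.
  - apply (Main O O); simpl; lia.
  - intros i [|d] Hi Hd; [lia|]. apply (Main (S d) i); simpl; lia.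
Qed.
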